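(* Let $d,n\ge 1$ be integers and let $f_1,\ldots,f_n:\mathbb{R}^d\to[0,\infty)$ be upper semi-continuous log-concave functions. For every nonempty $\sigma\subseteq\{1,\ldots,n\}$, let $f_\sigma$ denote the pointwise minimum $f_\sigma(x)=\min\{f_i(x): i\in\sigma\}$, and let $f=f_{\{1,\ldots,n\}}$. Then there is a nonempty set $\sigma\subseteq\{1,\ldots,n\}$ of at most $3d+2$ indices such that $$\int_{\mathbb{R}^d} f_\sigma\ \le\ (100\,d)^{5d/2}\int_{\mathbb{R}^d} f .$$
   Context: A function $f:\mathbb{R}^d\to[0,\infty)$ is log-concave if $f=e^{-\psi}$ for some convex $\psi:\mathbb{R}^d\to\mathbb{R}\cup\{\infty\}$ (with $e^{-\infty}=0$). Integrals are Lebesgue integrals with values in $[0,\infty]$. *)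

(* Defs.v *)
From HB Require Import structures.
From mathcomp Require Import all_boot all_order all_algebra.
From mathcomp Require Import all_classical all_reals all_analysis.

Set Implicit Arguments.
Unset Strict Implicit.
Unset Printing Implicit Defensive.

Import Order.TTheory GRing.Theory Num.Theory.
Import numFieldNormedType.Exports.

Local Open Scope classical_set_scope.
Local Open Scope ring_scope.

Definition rV_display : measure_display.
Proof. exact: default_measure_display. Qed.

(* The product sigma-algebra on R^n, generated by the n coordinate maps, which
   is also the Borel sigma-algebra of 'rV[R]_n (open_measurable_rV below gives
   the nontrivial inclusion). *)
Section measurable_rV.
Context {R : realType} (n : nat).

Let coord : 'I_n -> 'rV[R]_n -> R := fun i v => v ord0 i.

Let measurable_rV0 : g_sigma_preimage coord set0.
Proof. exact: sigma_algebra0. Qed.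

Let measurable_rVC A :
  g_sigma_preimage coord A -> g_sigma_preimage coord (~` A).
Proof. exact: sigma_algebraC. Qed.

Let measurable_rV_bigcup (F : (set 'rV[R]_n)^nat) :
  (forall i, g_sigma_preimage coord (F i)) ->
  g_sigma_preimage coord (\bigcup_i (F i)).
Proof. exact: sigma_algebra_bigcup. Qed.

HB.instance Definition _ := @isMeasurable.Build rV_display 'rV[R]_n
  (g_sigma_preimage coord) measurable_rV0 measurable_rVC measurable_rV_bigcup.

End measurable_rV.

Lemma measurable_coord (R : realType) n (i : 'I_n) :
  measurable_fun [set: 'rV[R]_n] (fun v => v ord0 i).
Proof.
move=> _ Y mY; rewrite setTI; apply: sub_sigma_algebra => /=.
rewrite -bigcup_seq/=; exists i => /=; first by rewrite mem_index_enum.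
by exists Y => //; rewrite setTI.
Qed.

Lemma measurable_fun_rVP (R : realType) n d (T : measurableType d)
    (f : T -> 'rV[R]_n) :
  measurable_fun [set: T] f <->
  forall i, measurable_fun [set: T] (fun t => f t ord0 i).
Proof.
split=> [mf i|mf _ A mA].
  exact: (measurableT_comp (measurable_coord i) mf).
rewrite setTI; move: A mA.
pose G := [set A : set 'rV[R]_n | measurable (f @^-1` A)].
change (measurable `<=` G).
apply: smallest_sub.
  split=> [|A GA|F GF]; rewrite /G/=.
  - by rewrite preimage_set0.
  - by rewrite setTD preimage_setC; exact: measurableC.
  - by rewrite preimage_bigcup; exact: bigcupT_measurable.
rewrite -bigcup_seq => A [i _] [B mB <-]; rewrite setTI /G/=.
by have := mf i measurableT B mB; rewrite setTI.
Qed.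

Lemma open_measurable_rV (R : realType) n (A : set 'rV[R]_n) :
  open A -> measurable A.
Proof.
move=> oA.
pose B (p : 'rV[rat]_n * nat) : set 'rV[R]_n :=
  [set v | forall i, ball (ratr (p.1 ord0 i) : R) p.2.+1%:R^-1 (v ord0 i)].
have -> : A = \bigcup_(p in [set p | B p `<=` A]) B p.
  apply/seteqP; split=> [v Av|v [p Bp]]; last exact: Bp.
  have /nbhs_ballP[e /= e0 eA] : nbhs v A by exact: open_nbhs_nbhs.
  have [k ke] : exists k, k.+1%:R^-1 < e / 2.
    have [k _ ke] := near_infty_natSinv_lt (PosNum (divr_gt0 e0 (ltr0n R 2))).
    by exists k; exact: (ke k (leqnn k)).
  have k0 : 0 < k.+1%:R^-1 :> R by rewrite invr_gt0.
  have /choice[q qv] (i : 'I_n) : exists q : rat,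
      `|ratr q - v ord0 i| < k.+1%:R^-1.
    have [|q] := @rat_in_itvoo R (v ord0 i) (v ord0 i + k.+1%:R^-1).
      by rewrite ltrDl.
    rewrite in_itv/= => /andP[vq qv]; exists q.
    by rewrite ger0_norm ?subr_ge0 ?ltW// ltrBlDl.
  exists (\row_i q i, k) => /= [w wB|i]; last by rewrite mxE; exact: qv.
  apply: eA; split=> // i j; rewrite ord1 /ball/=.
  have := wB j; rewrite /ball/= mxE => wj.
  rewrite -(subrK (ratr (q j)) (v ord0 j)) -addrA.
  rewrite (le_lt_trans (ler_normD _ _))// (splitr e) ltrD//.
    by rewrite distrC (lt_trans (qv j)).
  exact: lt_trans wj ke.
rewrite bigcup_mkcond; apply: countable_bigcupT_measurable => [|p].
  exact: countableP.
case: ifPn => // _.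
rewrite [X in measurable X](_ : _ = \bigcap_(i in [set: 'I_n])
  ((fun v : 'rV[R]_n => v ord0 i) @^-1`
     ball (ratr (p.1 ord0 i) : R) p.2.+1%:R^-1)).
  apply: fin_bigcap_measurable => // i _.
  rewrite -[X in measurable X]setTI; apply: measurable_coord => //.
  by rewrite ball_itv; exact: measurable_itv.
by apply/seteqP; split=> v /= Bv i => [_|]; exact: Bv.
Qed.

Definition cons_rV (R : realType) n (p : measurableTypeR R * 'rV[R]_n) :
    'rV[R]_n.+1 :=
  \row_i if unlift ord0 i is Some j then p.2 ord0 j else p.1.

Lemma cons_rV0 (R : realType) n (p : measurableTypeR R * 'rV[R]_n) :
  cons_rV p ord0 ord0 = p.1.
Proof. by rewrite mxE unlift_none. Qed.

Lemma cons_rV_lift (R : realType) n (p : measurableTypeR R * 'rV[R]_n) j :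
  cons_rV p ord0 (lift ord0 j) = p.2 ord0 j.
Proof. by rewrite mxE liftK. Qed.

Lemma measurable_cons_rV (R : realType) n :
  measurable_fun setT (@cons_rV R n).
Proof.
apply/measurable_fun_rVP => i.
have [j ->|->] := unliftP ord0 i.
  under eq_fun do rewrite cons_rV_lift.
  exact: (measurableT_comp (measurable_coord j) measurable_snd).
under eq_fun do rewrite cons_rV0.
exact: measurable_fst.
Qed.

Section lebesgue_rV_step.
Context {R : realType} n (mu : {sigma_finite_measure set 'rV[R]_n -> \bar R}).
Local Open Scope ereal_scope.

Definition lebesgue_rV_step : set 'rV[R]_n.+1 -> \bar R :=
  pushforward (lebesgue_measure \x mu) (@cons_rV R n).

Let lebesgue_rV_step0 : lebesgue_rV_step set0 = 0.
Proof. by rewrite /lebesgue_rV_step /pushforward preimage_set0 measure0. Qed.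

Let lebesgue_rV_step_ge0 A : 0 <= lebesgue_rV_step A.
Proof. by rewrite /lebesgue_rV_step /pushforward; exact: measure_ge0. Qed.

Let lebesgue_rV_step_sigma_additive : semi_sigma_additive lebesgue_rV_step.
Proof.
move=> F mF tF mUF; rewrite /lebesgue_rV_step /pushforward preimage_bigcup.
have mcons A : measurable A -> measurable (@cons_rV R n @^-1` A).
  by move=> mA; rewrite -[X in measurable X]setTI; exact: measurable_cons_rV.
apply: measure_semi_sigma_additive.
- by move=> k; exact: mcons.
- apply/trivIsetP => /= i j _ _ ij; rewrite -preimage_setI.
  by move/trivIsetP : tF => /(_ _ _ _ _ ij) ->//; rewrite preimage_set0.
- by rewrite -preimage_bigcup; exact: mcons.
Qed.

HB.instance Definition _ := isMeasure.Build _ _ _ lebesgue_rV_step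
  lebesgue_rV_step0 lebesgue_rV_step_ge0 lebesgue_rV_step_sigma_additive.

Let lebesgue_rV_step_sigma_finite : sigma_finite setT lebesgue_rV_step.
Proof.
have [F TF Foo] : sigma_finite setT (lebesgue_measure \x mu).
  have /sigma_finiteP[F [TF ndF Foo]] :=
    sigma_finiteT
      (@lebesgue_measure R : {sigma_finite_measure set _ -> \bar R}).
  have /sigma_finiteP[G [TG ndG Goo]] := sigma_finiteT mu.
  exists (fun k => F k `*` G k) => [|k].
    rewrite -setXTT TF TG predeqE => -[x v]; split.
      move=> [/= [k _ Fkx] [l _ Glv]]; exists (maxn k l) => //; split.
      - by move: x Fkx; exact/subsetPset/ndF/leq_maxl.
      - by move: v Glv; exact/subsetPset/ndG/leq_maxr.
    by move=> [k _ [/= ? ?]]; split; exists k.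
  have [mF Fk] := Foo k; have [mG Gk] := Goo k.
  split; first exact: measurableX.
  by rewrite product_measure1E// lte_mul_pinfty// ge0_fin_numE.
pose uncons (w : 'rV[R]_n.+1) : measurableTypeR R * 'rV[R]_n :=
  (w ord0 ord0, \row_j w ord0 (lift ord0 j)).
have consK : cancel (@cons_rV R n) uncons.
  move=> [x v]; rewrite /uncons cons_rV0; congr pair.
  by apply/rowP => j; rewrite mxE cons_rV_lift.
have muncons : measurable_fun setT uncons.
  apply/measurable_fun_pairP; split; first exact: measurable_coord.
  apply/measurable_fun_rVP => i /=.
  under eq_fun do rewrite mxE.
  exact: measurable_coord.
exists (fun k => uncons @^-1` F k) => [|k].
  by rewrite -preimage_bigcup -TF preimage_setT.
have [mF Fk] := Foo k; split.
  by rewrite -[X in measurable X]setTI; exact: muncons.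
rewrite /lebesgue_rV_step /pushforward -comp_preimage.
by rewrite (_ : _ @^-1` F k = F k)//; apply/funext => p/=; rewrite consK.
Qed.

HB.instance Definition _ := Measure_isSigmaFinite.Build _ _ _ lebesgue_rV_step
  lebesgue_rV_step_sigma_finite.

End lebesgue_rV_step.

(* Lebesgue measure on R^n as the n-fold product of the one on R; on R^0 it is
   the unit mass at the only point. *)
Fixpoint lebesgue_rV {R : realType} n :
    {sigma_finite_measure set 'rV[R]_n -> \bar R} :=
  match n with
  | 0 => \d_(0 : 'rV[R]_0)
  | m.+1 => lebesgue_rV_step (lebesgue_rV m)
  end.

Lemma lebesgue_rV_box (R : realType) n (A : 'I_n -> set R) :
  (forall i, measurable (A i)) ->
  lebesgue_rV n [set v | forall i, A i (v ord0 i)] =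
  (\prod_(i < n) lebesgue_measure (A i))%E.
Proof.
elim: n A => [|n IHn] A mA.
  by rewrite big_ord0 /= diracE mem_set//= => -[].
rewrite big_ord_recl -IHn//= /lebesgue_rV_step /pushforward.
have mB : measurable [set v : 'rV[R]_n | forall i, A (lift ord0 i) (v ord0 i)].
  rewrite [X in measurable X](_ : _ = \bigcap_(i in [set: 'I_n])
    ((fun v : 'rV[R]_n => v ord0 i) @^-1` A (lift ord0 i))).
    apply: fin_bigcap_measurable => // i _.
    by rewrite -[X in measurable X]setTI; exact: measurable_coord.
  by apply/seteqP; split=> v /= Av i => [_|]; exact: Av.
rewrite -product_measure1E//; last exact: (mA ord0).
congr (_ _); apply/seteqP; split=> [p /= Ap|p /= [A0 Ap] i].
  split=> [|i]; first by have := Ap ord0; rewrite cons_rV0.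
  by have := Ap (lift ord0 i); rewrite cons_rV_lift.
have [j ->|->] := unliftP ord0 i; last by rewrite cons_rV0.
by rewrite cons_rV_lift; exact: Ap.
Qed.

Definition upper_semicontinuous (R : realType) (X : topologicalType)
    (f : X -> R) :=
  forall x a, f x < a -> \forall y \near x, f y < a.

(* In the inequality, 0 * +oo = 0 at the endpoints t = 0 and t = 1, where it
   holds trivially. *)
Definition econvex (R : realType) (E : lmodType R) (psi : E -> \bar R) :=
  forall (x y : E) (t : R), 0 <= t <= 1 ->
  (psi (t *: x + (1 - t) *: y)%R <= t%:E * psi x + (1 - t)%:E * psi y)%E.

Definition log_concave (R : realType) (E : lmodType R) (f : E -> R) :=
  exists psi : E -> \bar R,
    [/\ forall x, psi x != -oo%E,
        econvex psi &
        forall x, (f x)%:E = expeR (- psi x)].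

(* For nonempty s this is the minimum of the f i x over i in s; the neutral
   element +oo is reached only when s is empty. *)
Definition min_fun_over (R : realType) (I : finType) (T : Type)
    (f : I -> T -> R) (s : {set I}) (x : T) : \bar R :=
  \big[Order.min/+oo%E]_(i in s) (f i x)%:E.

(* Main.v *)
Require Import Defs.
From mathcomp Require Import all_boot all_order all_algebra.
From mathcomp Require Import all_classical all_reals all_analysis.
From mathcomp Require Import measurable_realfun perm ring lra.

(* If the supports of the f_i have no common interior point, Helly's theorem
   for their interiors gives d + 1 of them whose common support is convex with
   empty interior, hence lies in a hyperplane.  Otherwise let M = sup f, which
   is finite when the integral of f is, and let K be the level set
   {f >= M / (2 * 4^d)}, a compact convex body and the intersection of the level
   sets K_i of the f_i.

   Helly's theorem for the sets {f_i > M} gives d + 1 indices whose minimum is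
   at most M.  A quantitative Helly theorem gives 2d further indices such that
   the intersection of their K_i lies in a homothetic copy of K of ratio
   L = 10 d^2.  It rests on almost maximal determinants.  For points of K they
   give a center g such that -(x - g) / (2d + 1) + g stays in K.  For the polar
   functionals of the K_i about g they give a_1, ..., a_d such that every other
   such functional is a combination of them with coefficients in [-2, 2].  The
   lower bound of a_1 + ... + a_d on K coming from g already holds on the
   intersection of d of the K_i, again by Helly, and then all functionals are
   bounded by L.

   Log-concavity with respect to a point where f >= M / 2 puts the k-th level
   shell of the selected minimum into a copy of K of ratio (k + 1) L, and
   summing over the shells compares both integrals with M times the volume of
   K. *)

Import Order.TTheory GRing.Theory Num.Theory.
Import numFieldNormedType.Exports.

Set Implicit Arguments.
Unset Strict Implicit.
Unset Printing Implicit Defensive.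

Local Open Scope classical_set_scope.
Local Open Scope ring_scope.

(** * Convex combinations and Helly's theorem *)

Definition is_convex (R : realType) (E : lmodType R) (C : set E) :=
  forall (x y : E) (t : R), 0 <= t <= 1 -> C x -> C y ->
    C (t *: x + (1 - t) *: y).

(** Induction on the list of indices; partial sums are normalised by their weight, since only the
    total weight is known to be 1. *)
Lemma convex_combination (R : realType) (E : lmodType R) (C : set E)
    (I : finType) (P : pred I) (w : I -> R) (x : I -> E) :
  is_convex C -> (forall i, P i -> 0 <= w i) -> (forall i, P i -> C (x i)) ->
  \sum_(i | P i) w i = 1 -> C (\sum_(i | P i) w i *: x i).
Proof.
move=> cC w0 Cx w1.
suff H (s : seq I) : 0 < \sum_(i <- s | P i) w i ->
    C ((\sum_(i <- s | P i) w i)^-1 *: \sum_(i <- s | P i) w i *: x i).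
  have := H (index_enum I); rewrite w1 invr1 scale1r; exact.
elim: s => [|i s IH]; first by rewrite big_nil ltxx.
rewrite !big_cons; case: ifPn => // Pi.
set W := \sum_(j <- s | P j) w j; set X := \sum_(j <- s | P j) _ => W0.
have Wge0 : 0 <= W by exact: sumr_ge0.
have wi0 := w0 _ Pi.
have [W00|Wn0] := eqVneq W 0.
  have -> : X = 0.
    rewrite /X big_seq_cond big1// => j /andP[js Pj].
    suff -> : w j = 0 by rewrite scale0r.
    apply/eqP; rewrite eq_le w0// andbT -W00 /W (big_rem _ js)/= Pj lerDl.
    exact: sumr_ge0.
  rewrite W00 !addr0 scalerA mulVf ?scale1r; first exact: Cx.
  by move: W0; rewrite W00 addr0; exact: lt0r_neq0.
have Wp : 0 < W by rewrite lt_neqAle eq_sym Wn0.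
have -> : (w i + W)^-1 *: (w i *: x i + X) =
    (w i / (w i + W)) *: x i + (1 - w i / (w i + W)) *: (W^-1 *: X).
  rewrite scalerDr !scalerA; congr (_ *: _ + _ *: _); field.
    exact: lt0r_neq0.
  by rewrite (lt0r_neq0 W0) (lt0r_neq0 Wp).
apply: cC => //; [|exact: Cx|exact: IH].
by rewrite divr_ge0 ?(ltW W0)//= ler_pdivrMr// mul1r lerDl.
Qed.

(* Radon: an affine dependence between points x_j, each chosen in all sets but
   the j-th, splits them into two groups with a common convex combination. *)
Lemma helly (R : realType) d (I : finType) (C : I -> set 'rV[R]_d) :
  (forall i, is_convex (C i)) -> (forall x, exists i, ~ C i x) ->
  exists J : {set I}, (#|J| <= d.+1)%N /\
    forall x, exists2 i, i \in J & ~ C i x.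
Proof.
move=> cC C0.
pose P (J : {set I}) := `[< forall x, exists2 i, i \in J & ~ C i x >].
have PT : P [set: I]%SET.
  by apply/asboolP => x; have [i Ci] := C0 x; exists i.
(* An inclusion-minimal subfamily without common point: omitting any one member leaves a common
   point of the others. *)
have [J /minsetP[/asboolP PJ minJ] _] := minset_exists PT.
exists J; split=> //; rewrite leqNgt; apply/negP => dJ.
have /choice[x Hx] (j : I) : exists x, j \in J ->
    forall i, i \in J -> i != j -> C i x.
  have [jJ|jJ] := boolP (j \in J); last by exists 0.
  have [y Hy] : exists y, ~ exists2 i, i \in (J :\ j)%SET & ~ C i y.
    apply/existsNP => PJj; have := minJ _ (asboolT PJj) (subD1set _ _).
    by move/setP => /(_ j); rewrite !inE eqxx jJ.
  exists y => _ i iJ ij; apply: contrapT => nC; apply: Hy; exists i => //.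
  by rewrite !inE ij.
pose k := #|J|.
(* [A] has more than [d + 1] rows, so its left kernel is nonzero; a kernel vector is an affine
   dependence of the chosen points. *)
pose A : 'M[R]_(k, 1 + d) := \matrix_i row_mx 1%:M (x (enum_val i)).
have : kermx A != 0.
  rewrite -mxrank_eq0 mxrank_ker subn_eq0 -ltnNge.
  exact: leq_ltn_trans (rank_leq_col A) dJ.
case/rowV0Pn => v /sub_kermxP vA v0.
have v1 : \sum_i v 0 i = 0.
  have /rowP/(_ (lshift d 0)) := vA; rewrite !mxE => H; rewrite -[RHS]H.
  apply: eq_bigr => i _; rewrite mxE row_mxEl mxE eqxx mulr1//.
have vx : \sum_i v 0 i *: x (enum_val i) = 0.
  apply/rowP => j; have /rowP/(_ (rshift 1 j)) := vA; rewrite !mxE => H;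
    rewrite -[RHS]H.
  rewrite summxE; apply: eq_bigr => i _.
  by rewrite [LHS]mxE [A _ _]mxE row_mxEr.
pose Pos := [pred i | 0 < v 0 i].
pose W := \sum_(i | Pos i) v 0 i.
have WN : \sum_(i | ~~ Pos i) - v 0 i = W.
  rewrite /W/=; move: v1; rewrite (bigID Pos)/= => /eqP;
    rewrite addr_eq0 => /eqP ->.
  by rewrite sumrN.
have XN : \sum_(i | ~~ Pos i) - v 0 i *: x (enum_val i) =
    \sum_(i | Pos i) v 0 i *: x (enum_val i).
  rewrite /=; move: vx; rewrite (bigID Pos)/= => /eqP;
    rewrite addr_eq0 => /eqP ->.
  by rewrite -sumrN; apply: eq_bigr => i _; rewrite scaleNr.
have W0 : 0 < W.
  rewrite lt_neqAle sumr_ge0 ?andbT; last by move=> i /ltW.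
  apply: contraNneq v0 => /esym W00; apply/eqP/rowP => i; rewrite mxE.
  have [vi|vi] := ltP 0 (v 0 i).
    move/eqP: W00; rewrite psumr_eq0; last by move=> ? /ltW.
    by move=> /allP/(_ i); rewrite mem_index_enum => /(_ isT)/implyP/(_ vi)/eqP.
  move/eqP: WN; rewrite W00 psumr_eq0.
    move=> /allP/(_ i); rewrite mem_index_enum -leNgt => /(_ isT)/implyP/(_ vi).
    by rewrite oppr_eq0 => /eqP.
  by move=> j; rewrite -leNgt oppr_ge0.
pose z := \sum_(i | Pos i) (v 0 i / W) *: x (enum_val i).
have zN : z = \sum_(i | ~~ Pos i) (- v 0 i / W) *: x (enum_val i).
  rewrite /z; under eq_bigr do rewrite mulrC -scalerA.
  under [RHS]eq_bigr do rewrite mulrC -scalerA.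
  by rewrite -!scaler_sumr XN.
(* The group that does not contain the index [i] expresses [z] through points of [C i] only. *)
have [i iJ []] := PJ z.
have [i0 ik] : exists i0 : 'I_k, i = enum_val i0.
  by exists (enum_rank_in iJ i); rewrite enum_rankK_in.
have [Pi|Pi] := boolP (Pos i0).
- rewrite zN; apply: convex_combination => //.
  + by move=> j; rewrite /= -leNgt => vj; rewrite divr_ge0 ?oppr_ge0// ltW.
  + move=> j Pj; apply: Hx => //; first exact: enum_valP.
    by apply: contraNneq Pj; rewrite ik => /enum_val_inj <-.
  + by rewrite -mulr_suml WN divff// lt0r_neq0.
- rewrite /z; apply: convex_combination => //.
  + by move=> j /ltW vj; rewrite divr_ge0// ltW.
  + move=> j Pj; apply: Hx => //; first exact: enum_valP.
    by apply: contraNneq Pi; rewrite ik => /enum_val_inj ->.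
  + by rewrite -mulr_suml divff// lt0r_neq0.
Qed.

(** * Spanning families and determinants *)

(** Spanning is stated by duality. Rows are added one at a time: a nonzero column of [cokermx M] is
    killed by the rows of [M], so an element of [A] that it does not kill is independent of them. *)
Lemma basis_of_spanning (F : fieldType) N (A : set 'rV[F]_N) :
  (forall u : 'cV[F]_N, (forall a, A a -> a *m u = 0) -> u = 0) ->
  exists M : 'M[F]_N, (forall i, A (row i M)) /\ M \in unitmx.
Proof.
move=> spanA.
suff H k : (k <= N)%N ->
    exists M : 'M[F]_(k, N), (forall i, A (row i M)) /\ row_free M.
  have [M [AM Mf]] := H N (leqnn N); exists M; split=> //.
  by rewrite -row_free_unit.
elim: k => [_|k IH kN].
  exists 0; split=> [[]//|]; by rewrite /row_free mxrank0.
have [M [AM Mf]] := IH (ltnW kN).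
have C0 : cokermx M != 0.
  rewrite -mxrank_eq0 mxrank_coker subn_eq0 -ltnNge.
  exact: leq_ltn_trans (rank_leq_row M) kN.
have [j uj] : exists j, col j (cokermx M) != 0.
  apply: contrapT => /forallNP H; move/negP: C0; apply.
  apply/eqP/matrixP => i j; have /negP/negPn/eqP/matrixP/(_ i 0) := H j.
  by rewrite !mxE.
have [a [Aa au]] : exists a, A a /\ a *m col j (cokermx M) != 0.
  apply: contrapT => /forallNP H; move/negP: uj; apply; apply/eqP/spanA => a Aa.
  by apply/eqP/negPn/negP => au; apply: (H a).
exists (col_mx a M); split.
  move=> i; case: (@split_ordP 1 k i) => l ->.
    by have -> : row (lshift k l) (col_mx a M) = a by rewrite -[RHS](row_id l);
      exact: rowKu.
  by have -> : row (rshift 1 l) (col_mx a M) = row l M by exact: rowKd.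
have : (M < a + M)%MS.
  rewrite ltmxE addsmxSr/=; apply/negP => /(submx_trans (addsmxSl a M)).
  move=> /submxP[B aE]; move/negP: au; apply.
  by rewrite aE colE -mulmxA [M *m _]mulmxA mulmx_coker mul0mx mulmx0.
rewrite ltmxErank => /andP[_]; have /eqP -> := Mf => rk.
by rewrite /row_free eqn_leq rank_leq_row; apply: leq_trans rk _;
  rewrite addsmxE.
Qed.

(** Cramer's rule: in the expansion along row [i] the cofactors are those of [M]. *)
Lemma det_subst_row (F : fieldType) N (M : 'M[F]_N) (a : 'rV[F]_N) i :
  M \in unitmx ->
  \det (\matrix_j (if j == i then a else row j M)) =
  (a *m invmx M) 0 i * \det M.
Proof.
move=> Mu; set M' := \matrix_j _.
rewrite (expand_det_row M' i) /invmx Mu -scalemxAr mxE mulrAC mulVf ?mul1r.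
  rewrite mxE; apply: eq_bigr => j _; rewrite !mxE eqxx; congr (_ * _).
  rewrite /cofactor; congr (_ * \det _); apply/matrixP => k l.
  by rewrite !mxE eq_sym (negbTE (neq_lift _ _)) mxE.
by rewrite -unitfE -unitmxE.
Qed.

(* A nearly maximal determinant: by Cramer's rule, the coordinates of a are
   ratios of determinants of matrices with rows in A. *)
Lemma almost_auerbach (R : realType) N (A : set 'rV[R]_N) D :
  (forall a, A a -> forall i, `|a 0 i| <= D) ->
  (forall u : 'cV[R]_N, (forall a, A a -> a *m u = 0) -> u = 0) ->
  exists M : 'M[R]_N, [/\ forall i, A (row i M), M \in unitmx &
    forall a, A a -> forall i, `|(a *m invmx M) 0 i| <= 2].
Proof.
move=> AD spanA; have [M0 [AM0 M0u]] := basis_of_spanning spanA.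
pose S := [set `|\det M| | M in [set M : 'M[R]_N | forall i, A (row i M)]].
have S0 : S (`|\det M0|) by exists M0.
have hS : has_sup S.
  split; first by exists (`|\det M0|).
  exists (\sum_(s : 'S_N) \prod_(i < N) D) => _ [M AM <-].
  rewrite /determinant (le_trans (ler_norm_sum _ _ _))// ler_sum// => s _.
  rewrite normrM normrX normrN1 expr1n mul1r normr_prod ler_prod// => i _.
  by rewrite normr_ge0/=; have := AD _ (AM i) (s i); rewrite mxE.
have d0 : 0 < `|\det M0| by rewrite normr_gt0 -unitfE -unitmxE.
have S1 : 0 < sup S by apply: lt_le_trans d0 _; exact: (ub_le_sup hS.2 S0).
(* [A] need not be closed, so the supremum may not be attained; a value above half of it suffices
   and is the source of the bound 2. *)
have [_ [M AM <-] dM] : exists2 y, S y & sup S - sup S / 2 < y.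
  by apply: sup_adherent => //; rewrite divr_gt0.
have dM0 : 0 < `|\det M| by lra.
have Mu : M \in unitmx by rewrite unitmxE unitfE -normr_gt0.
exists M; split=> // a Aa i.
have : S (`|(a *m invmx M) 0 i * \det M|).
  rewrite -det_subst_row//; exists (\matrix_j (if j == i then a else row j M)).
    by move=> j; rewrite rowK; case: ifP.
  by [].
move=> /(ub_le_sup hS.2); rewrite normrM => H.
rewrite -(ler_pM2r dM0); apply: le_trans H _; lra.
Qed.

(** * Cubes, simplices and barycentric coordinates *)

Definition cube (R : realType) d (p : 'rV[R]_d) (r : R) : set 'rV[R]_d :=
  [set y | forall i, `|y 0 i - p 0 i| < r].

(** Homogeneous coordinates: affine functions of [x] become linear functionals of [homog x]. *)
Definition homog (R : realType) d (x : 'rV[R]_d) : 'rV[R]_(1 + d) :=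
  row_mx 1%:M x.

Lemma cube_center (R : realType) d (p : 'rV[R]_d) r : 0 < r -> cube p r p.
Proof. by move=> r0 i; rewrite subrr normr0. Qed.

(** The entries of [homog x *m invmx M] are the barycentric coordinates of [x]: the first column of
    [M] yields their sum, the other columns the point. *)
Lemma barycentric (R : realType) d (M : 'M[R]_(1 + d))
    (v : 'I_(1 + d) -> 'rV[R]_d) x :
  (forall i, row i M = homog (v i)) -> M \in unitmx ->
  \sum_i (homog x *m invmx M) 0 i = 1 /\
  \sum_i (homog x *m invmx M) 0 i *: v i = x.
Proof.
move=> Mv Mu; have := mulmxKV Mu (homog x); move: (homog x *m _) => c.
have Mi i j : M i j = homog (v i) 0 j by rewrite -Mv mxE.
move=> /rowP cM; split.
  have := cM (lshift d 0); rewrite mxE [RHS]row_mxEl mxE eqxx => H;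
    rewrite -[RHS]H.
  by apply: eq_bigr => i _; rewrite Mi row_mxEl mxE mulr1.
apply/rowP => j; have := cM (rshift 1 j); rewrite mxE [RHS]row_mxEr => H;
  rewrite -[RHS]H.
by rewrite summxE; apply: eq_bigr => i _; rewrite Mi row_mxEr mxE.
Qed.

(** At the centroid all barycentric coordinates equal 1 / (d + 1). They are affine in the point, so
    they stay nonnegative on a small cube around it. *)
Lemma simplex_cube (R : realType) d (C : set 'rV[R]_d) (M : 'M[R]_(1 + d))
    (v : 'I_(1 + d) -> 'rV[R]_d) :
  is_convex C -> (forall i, row i M = homog (v i)) -> M \in unitmx ->
  (forall i, C (v i)) ->
  exists2 r, 0 < r & cube ((1 + d)%:R^-1 *: \sum_i v i) r `<=` C.
Proof.
move=> cC Mv Mu Cv; set g := _ *: _; set c : R := (1 + d)%:R^-1.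
have c0 : 0 < c by rewrite invr_gt0 ltr0n.
have gM : homog g *m invmx M = const_mx c.
  rewrite -[RHS](mulmxK Mu); congr (_ *m _).
  apply/rowP => j; rewrite [RHS]mxE.
  have Mi i k : M i k = homog (v i) 0 k by rewrite -Mv mxE.
  under eq_bigr do rewrite Mi mxE.
  rewrite -mulr_sumr; case: (split_ordP j) => k ->.
    under eq_bigr do rewrite row_mxEl mxE.
    rewrite row_mxEl mxE ord1 eqxx sumr_const card_ord /c.
    by rewrite mulVf// pnatr_eq0.
  under eq_bigr do rewrite row_mxEr.
  by rewrite row_mxEr mxE summxE.
pose B := \sum_i \sum_j `|invmx M i j|.
have B0 : 0 <= B by apply: sumr_ge0 => i _; apply: sumr_ge0.
exists (c / (B + 1)); first by rewrite divr_gt0// ltr_wpDl.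
move=> y Hy; have [s1 sy] := barycentric y Mv Mu.
rewrite -[X in C X]sy.
apply: (@convex_combination _ _ C _ xpredT
  (fun i => (homog y *m invmx M) 0 i)) => //.
move=> j _.
rewrite -[homog y](subrK (homog g)) mulmxDl gM mxE [X in _ + X]mxE.
suff H : `|((homog y - homog g) *m invmx M) 0 j| <= c.
  by rewrite -lerBlDr sub0r; move: H; rewrite ler_norml => /andP[].
rewrite opp_row_mx add_row_mx subrr mxE (le_trans (ler_norm_sum _ _ _))//.
apply: (@le_trans _ _ (\sum_i c / (B + 1) * `|invmx M i j|)).
  apply: ler_sum => i _; rewrite normrM ler_wpM2r//.
  have [k ik|k ik] := split_ordP i; rewrite ik.
    by rewrite row_mxEl mxE normr0 divr_ge0 ?(ltW c0)// addr_ge0.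
  by rewrite row_mxEr ltW//; have := Hy k; rewrite !mxE.
rewrite -mulr_sumr mulrAC ler_pdivrMr ?ltr_wpDl// ler_pM2l//.
rewrite (@le_trans _ _ B) ?lerDl// ler_sum// => i _.
by rewrite (bigD1 j)//= lerDl sumr_ge0.
Qed.

(** [u] is an affine function that vanishes at [p] and at shifts of [p] along each axis; hence its
    linear part is zero, and then its constant too. *)
Lemma cube_spanning (R : realType) d (S : set 'rV[R]_d) p r
    (u : 'cV[R]_(1 + d)) :
  0 < r -> cube p r `<=` S ->
  (forall a, (@homog R d @` S) a -> a *m u = 0) -> u = 0.
Proof.
move=> r0 pS Hu; rewrite -[u]vsubmxK.
have H x : S x -> usubmx u + x *m dsubmx u = 0.
  move=> Sx; have := Hu _ (ex_intro2 _ _ x Sx erefl).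
  by rewrite -[u in _ *m u]vsubmxK mul_row_col mul1mx.
have Hp := H _ (pS _ (cube_center p r0)).
have d0 : dsubmx u = 0.
  apply/colP => j; have : S (p + (r / 2) *: delta_mx 0 j).
    apply: pS => i; rewrite !mxE addrAC subrr add0r normrM.
    rewrite gtr0_norm ?divr_gt0//; case: (_ && _); rewrite ?normr1 ?normr0; lra.
  move=> /H; rewrite mulmxDl addrA Hp add0r -scalemxAl => /matrixP/(_ 0 0).
  rewrite -rowE !mxE => /eqP; rewrite mulf_eq0 => /orP[|/eqP->//].
  by rewrite gt_eqF// divr_gt0.
by move: Hp; rewrite d0 mulmx0 addr0 => ->; rewrite col_mx0.
Qed.

(** If no nonzero affine function vanishes on [S], then [S] contains the vertices of a nondegenerate
    simplex. In the second case the linear part of [u] may be zero, and then [S] is empty. *)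
Lemma convex_cube_or_hyperplane (R : realType) d (S : set 'rV[R]_d) :
  is_convex S ->
  (exists g r, 0 < r /\ cube g r `<=` S) \/
  (exists2 u : 'cV[R]_(1 + d), u != 0 & forall x, S x -> homog x *m u = 0).
Proof.
move=> cS; have [H|] := pselect (forall u : 'cV[R]_(1 + d),
    (forall a, (@homog R d @` S) a -> a *m u = 0) -> u = 0).
  left; have [M [AM Mu]] := basis_of_spanning H.
  have /choice[v Hv] i : exists v, S v /\ row i M = homog v.
    by have [v Sv vM] := AM i; exists v.
  have [r r0 Hr] := simplex_cube cS (fun i => (Hv i).2) Mu (fun i => (Hv i).1).
  by exists ((1 + d)%:R^-1 *: \sum_i v i), r.
move=> /existsNP[u /not_implyP[Hu /eqP u0]]; right; exists u => // x Sx.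
by apply: Hu; exists x.
Qed.

(** * Scalar product and separation of a point from a convex set *)

Definition dot (R : realType) d (x y : 'rV[R]_d) : R := \sum_i x 0 i * y 0 i.

Lemma dotC (R : realType) d (x y : 'rV[R]_d) : dot x y = dot y x.
Proof. by apply: eq_bigr => i _; rewrite mulrC. Qed.

Lemma dotDr (R : realType) d (x y z : 'rV[R]_d) :
  dot x (y + z) = dot x y + dot x z.
Proof. by rewrite -big_split; apply: eq_bigr => i _; rewrite mxE mulrDr. Qed.

Lemma dotZr (R : realType) d (x y : 'rV[R]_d) t : dot x (t *: y) = t * dot x y.
Proof. by rewrite mulr_sumr; apply: eq_bigr => i _; rewrite mxE mulrCA. Qed.

Lemma dotBr (R : realType) d (x y z : 'rV[R]_d) :
  dot x (y - z) = dot x y - dot x z.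
Proof. by rewrite dotDr -scaleN1r dotZr mulN1r. Qed.

Lemma dotZl (R : realType) d (x y : 'rV[R]_d) t : dot (t *: y) x = t * dot y x.
Proof. by rewrite dotC dotZr dotC. Qed.

Lemma dot_sqrB (R : realType) d (x y : 'rV[R]_d) :
  dot (x - y) (x - y) = dot x x - 2 * dot x y + dot y y.
Proof. by rewrite dotBr !(dotC (_ - _)) !dotBr (dotC y x); ring. Qed.

Lemma dot_ge0 (R : realType) d (x : 'rV[R]_d) : 0 <= dot x x.
Proof. by apply: sumr_ge0 => i _; rewrite -expr2 sqr_ge0. Qed.

Lemma dot_eq0 (R : realType) d (x : 'rV[R]_d) : (dot x x == 0) = (x == 0).
Proof.
apply/eqP/eqP => [/eqP|->]; last by rewrite /dot big1// => i _;
  rewrite mxE mul0r.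
rewrite psumr_eq0 => [/allP H|i _]; last by rewrite -expr2 sqr_ge0.
apply/rowP => i; rewrite mxE; have := H i; rewrite mem_index_enum => /(_ isT).
by rewrite -expr2 sqrf_eq0 => /eqP.
Qed.

Lemma cube_line (R : realType) d (p b : 'rV[R]_d) r : 0 < r ->
  exists2 s, 0 < s & cube p r (p + s *: b).
Proof.
move=> r0; have B0 : 0 <= \sum_i `|b 0 i| by exact: sumr_ge0.
have B1 : 0 < 1 + \sum_i `|b 0 i| by lra.
exists (r / (1 + \sum_i `|b 0 i|)); first by rewrite divr_gt0.
move=> i; rewrite !mxE addrAC subrr add0r normrM gtr0_norm ?divr_gt0//.
rewrite mulrAC ltr_pdivrMr// ltr_pM2l// (bigD1 i)//= addrCA ltrDl.
by rewrite ltr_wpDr// sumr_ge0.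
Qed.

(** The points of [C] no farther from [x] than [g] form a compact set, on which the squared distance
    attains its minimum. *)
Lemma closed_nearest_point (R : realType) d (C : set 'rV[R]_d) g x :
  closed C -> C g ->
  exists2 q, C q & forall z, C z -> dot (q - x) (q - x) <= dot (z - x) (z - x).
Proof.
move=> clC Cg; pose f (z : 'rV[R]_d) := dot (z - x) (z - x).
have cf : continuous f.
  apply: (@continuous_big R 'I_d +%R 0 xpredT _ 'rV[R]_d (index_enum 'I_d)
    (fun i z => (z - x) 0 i * (z - x) 0 i)); first exact: add_continuous.
  move=> i _ z; have ci : (fun z : 'rV[R]_d => (z - x) 0 i) @ z --> (z - x) 0 i.
    under eq_fun do rewrite !mxE; rewrite !mxE.
    exact: (cvgB (@coord_continuous R 1 d 0 i z) (cvg_cst (x 0 i))).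
  exact: (cvgM ci ci).
pose C' := C `&` [set z | f z <= f g].
have [|||q] := @EVT_min_rV R d f C'.
- by exists g; split => /=.
- have S0 : 0 <= \sum_i `|x 0 i| by exact: sumr_ge0.
  have fg0 : 0 <= f g by exact: dot_ge0.
  apply: bounded_closed_compact.
    (* The summand 1 is there because a number is at most its square plus 1. *)
    exists (\sum_i `|x 0 i| + f g + 1); split; first exact: num_real.
    move=> B HB z [_ fz]; rewrite /Num.norm/= mx_normrE; apply: bigmax_le.
      by apply: le_trans (ltW HB); rewrite !addr_ge0.
    move=> [i j] _ /=; rewrite ord1; apply: le_trans (ltW HB).
    rewrite -[z 0 j](subrK (x 0 j)) (le_trans (ler_normD _ _))// addrC -addrA.
    apply: lerD; first by rewrite (bigD1 j)//= lerDl sumr_ge0.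
    have zj : `|z 0 j - x 0 j| ^+ 2 <= f g.
      apply: le_trans fz; rewrite /f /dot (bigD1 j)//= !mxE real_normK
        ?num_real//.
      by rewrite expr2 lerDl; apply: sumr_ge0 => i0 _; rewrite -expr2 sqr_ge0.
    have := normr_ge0 (z 0 j - x 0 j); nra.
  apply: closedI => //; apply: (@closed_comp _ _ f [set t | t <= f g]).
    by move=> z _; exact: cf.
  exact: closed_le.
- exact: continuous_subspaceT.
move=> /set_mem[Cq qg] Hq; exists q => // z Cz.
have [zg|/ltW zg] := leP (f z) (f g); first by apply: Hq; rewrite inE.
exact: le_trans zg.
Qed.

(** For the point [q] of [C] nearest to [x], the functional [b = x - q] is maximal on [C] at [q]. It
    is smaller at the interior point [g], so it can be scaled to have value 1 at [q - g]. *)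
Lemma separation (R : realType) d (C : set 'rV[R]_d) g r x :
  closed C -> is_convex C -> 0 < r -> cube g r `<=` C -> ~ C x ->
  exists2 a, (forall z, C z -> dot a (z - g) <= 1) & 1 < dot a (x - g).
Proof.
move=> clC cC r0 gC nCx; have Cg := gC _ (cube_center g r0).
have [q Cq Hq] := closed_nearest_point x clC Cg.
pose b := x - q.
have bq z : C z -> dot b (z - q) <= 0.
  move=> Cz; set n := dot (z - q) (z - q).
  have n0 : 0 <= n by exact: dot_ge0.
  have Ht t : 0 <= t <= 1 -> 0 <= t * (t * n - 2 * dot b (z - q)).
    move=> t01; have := Hq _ (cC _ _ _ t01 Cz Cq).
    have -> : t *: z + (1 - t) *: q - x = t *: (z - q) - b.
      by rewrite /b opprB scalerBr scalerBl scale1r -!addrA; congr (_ + _);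
        rewrite addrCA.
    have -> : q - x = - 1 *: b by rewrite scaleN1r opprB.
    rewrite dot_sqrB !(dotZr,dotZl) -/n (dotC _ b); lra.
  rewrite leNgt; apply/negP => e0; move: e0 Ht; move: (dot b _) => e e0 Ht.
  have ne : 0 < n + e by lra.
  (* This [t] is at most 1, also when [n = 0], and satisfies t n < 2 e. *)
  have := Ht (e / (n + e)); rewrite divr_ge0 ?(ltW ne) ?(ltW e0)//=.
  rewrite ler_pdivrMr// mul1r lerDr => /(_ n0); rewrite pmulr_rge0 ?divr_gt0//.
  have : e / (n + e) * n < 2 * e; last by lra.
  by rewrite mulrAC ltr_pdivrMr//; nra.
have b0 : 0 < dot b b.
  rewrite lt_neqAle dot_ge0 andbT eq_sym dot_eq0 subr_eq0.
  by apply: contra_notN nCx => /eqP ->.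
(* Moving from [g] in the direction [b] stays in [C] for a while, which makes the value of [b] at
   [g] strictly smaller than at [q]. *)
have [s s0 /gC/bq] := cube_line g b r0.
rewrite addrAC dotDr dotZr => sb.
have be : 0 < dot b (q - g).
  rewrite -opprB -scaleN1r dotZr mulN1r oppr_gt0.
  have sb0 : 0 < s * dot b b by exact: mulr_gt0.
  lra.
exists ((dot b (q - g))^-1 *: b) => [z Cz|].
  rewrite dotZl mulrC ler_pdivrMr// mul1r.
  by have := bq _ Cz; rewrite !dotBr; lra.
rewrite dotZl mulrC ltr_pdivlMr// mul1r -subr_gt0 -dotBr.
by rewrite opprB addrA subrK.
Qed.

Lemma dot_delta (R : realType) d (a : 'rV[R]_d) j :
  dot a (delta_mx 0 j) = a 0 j.
Proof.
rewrite /dot (bigD1 j)//= mxE !eqxx mulr1 big1 ?addr0// => i ij.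
by rewrite mxE (negbTE ij) andbF mulr0.
Qed.

(** * Quantitative Helly theorem for convex bodies *)

(** [g] is the centroid of a simplex of almost maximal determinant. The barycentric coordinates c_i
    of [x] are at most 2 and sum to 1, so the weights (2 - c_i) / (2 d + 1) are nonnegative with sum
    1, and they represent the reflected point. *)
Lemma center_of_symmetry (R : realType) d (C : set 'rV[R]_d) p r D :
  is_convex C -> 0 < r -> cube p r `<=` C ->
  (forall x, C x -> forall j, `|x 0 j| <= D) ->
  exists g r', [/\ 0 < r', cube g r' `<=` C &
    forall x, C x -> C (g - (2 * d%:R + 1)^-1 *: (x - g))].
Proof.
move=> cC r0 pC CD; set m : R := 2 * d%:R + 1.
have m0 : 0 < m by rewrite ltr_wpDl// mulr_ge0.
have [|M [AM Mu M2]] := @almost_auerbach R _ (@homog R d @` C) (1 + `|D|) _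
    (fun u => cube_spanning r0 pC).
  move=> _ [x Cx <-] i; case: (split_ordP i) => k ->.
    by rewrite row_mxEl mxE ord1 eqxx normr1 lerDl.
  by rewrite row_mxEr (le_trans (CD _ Cx _))// (le_trans (ler_norm _))// lerDr.
have /choice[v Hv] i : exists v, C v /\ row i M = homog v.
  by have [v Cv vM] := AM i; exists v.
have Mv i := (Hv i).2; have Cv i := (Hv i).1.
have [r' r'0 Hr'] := simplex_cube cC Mv Mu Cv.
exists ((1 + d)%:R^-1 *: \sum_i v i), r'; split=> // x Cx.
have [s1 sx] := barycentric x Mv Mu.
have := M2 _ (ex_intro2 _ _ x Cx erefl).
move: (homog x *m _) s1 sx => c s1 sx c2.
have -> : (1 + d)%:R^-1 *: (\sum_i v i) -
    m^-1 *: (x - (1 + d)%:R^-1 *: (\sum_i v i)) =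
    \sum_i ((2 - c 0 i) / m) *: v i.
  under [RHS]eq_bigr do rewrite mulrC -scalerA scalerBl.
  rewrite -scaler_sumr sumrB sx -scaler_sumr.
  move: (\sum_i v i) => V; rewrite !scalerBr opprB addrA !scalerA.
  rewrite -scalerDl; congr (_ *: _ - _).
  rewrite natrD /m; field.
  have dge0 : 0 <= d%:R :> R by [].
  by apply/andP; split; apply: lt0r_neq0; lra.
apply: (@convex_combination _ _ C _ xpredT (fun i => (2 - c 0 i) / m)) => //.
  move=> i _; rewrite divr_ge0 ?(ltW m0)// subr_ge0.
  by rewrite (le_trans (ler_norm _)).
rewrite -mulr_suml sumrB s1 sumr_const card_ord.
by rewrite -[2 *+ _]mulr_natr natrD -[RHS](divff (lt0r_neq0 m0)) /m;
  congr (_ / _); ring.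
Qed.

(* The functionals a with a.(x - g) <= 1 on some K i form the polar body about
   g; x lies in the L-fold dilate of all K i once a.(x - g) <= L for all of
   them. *)
Lemma helly_homothet (R : realType) d n (K : 'I_n -> set 'rV[R]_d) p r D :
  (0 < d)%N -> (forall i, closed (K i)) -> (forall i, is_convex (K i)) ->
  0 < r -> (forall i, cube p r `<=` K i) ->
  (forall x, (forall i, K i x) -> forall j, `|x 0 j| <= D) ->
  exists s : {set 'I_n}, (#|s| <= 2 * d)%N /\ exists g, forall x,
    (forall i, i \in s -> K i x) ->
    forall i, K i (g + (10 * d%:R ^+ 2)^-1 *: (x - g)).
Proof.
move=> d0 clK cK r0 pK KD.
pose KK := [set x | forall i, K i x].
have cKK : is_convex KK by move=> x y t t01 Kx Ky i; exact: cK.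
have [g [r' [r'0 gKK gsym]]] :=
  center_of_symmetry cKK r0 (fun x Hx i => pK i x Hx) KD.
have Kg i : K i g := gKK _ (cube_center g r'0) i.
have gK i : cube g r' `<=` K i by move=> x /gKK.
set m : R := 2 * d%:R + 1 in gsym.
have m0 : 0 < m by rewrite ltr_wpDl// mulr_ge0.
have d1 : 1 <= d%:R :> R by rewrite ler1n.
pose A := [set a : 'rV[R]_d | exists i, forall x, K i x -> dot a (x - g) <= 1].
have notK i x : ~ K i x -> exists2 a, A a & 1 < dot a (x - g).
  move=> Kx; have [a Ha ax] := separation (clK i) (cK i) r'0 (gK i) Kx.
  by exists a => //; exists i.
(* The cube about [g] bounds the functionals by [2 / r']. They span, since a direction killed by all
   of them would give a line through [g] inside every [K i], against the bound [D]. *)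
have [||M [AM Mu M2]] := @almost_auerbach R d A (2 / r').
- move=> a [i Ha] j.
  have H s : `|s| = r' / 2 -> s * a 0 j <= 1.
    move=> sr; rewrite -dot_delta -dotZr.
    have <- : g + s *: delta_mx 0 j - g = s *: delta_mx 0 j.
      by rewrite addrAC subrr add0r.
    apply/Ha/gK => k; rewrite !mxE addrAC subrr add0r normrM sr.
    by case: (_ && _); rewrite ?normr1 ?normr0; lra.
  have H1 : r' / 2 * a 0 j <= 1 by apply: H; rewrite gtr0_norm ?divr_gt0.
  have H2 : - (r' / 2) * a 0 j <= 1.
    by apply: H; rewrite normrN gtr0_norm ?divr_gt0.
  rewrite ler_norml lerNl !ler_pdivlMr//; apply/andP; split; lra.
- move=> u Hu; apply/colP => j; rewrite mxE.
  have Ku s i : K i (g + s *: u^T).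
    apply: contrapT => /notK[a Aa]; rewrite addrAC subrr add0r dotZr.
    have -> : dot a u^T = (a *m u) 0 0.
      by rewrite mxE; apply: eq_bigr => k _; rewrite mxE.
    by rewrite Hu// mxE mulr0 ltr10.
  apply: contrapT => /eqP uj.
  have := KD _ (Ku ((D + `|g 0 j| + 1) / u j 0)) j.
  rewrite !mxE divfK// ler_norml => /andP[_].
  have := lerNnormlW (lexx `|g 0 j|); lra.
have /choice[k Hk] j : exists i, forall x, K i x -> dot (row j M) (x - g) <= 1.
  exact: AM.
pose T (x : 'rV[R]_d) := \sum_j dot (row j M) (x - g).
have Tcomb x y t : T (t *: x + (1 - t) *: y) = t * T x + (1 - t) * T y.
  rewrite /T !mulr_sumr -big_split; apply: eq_bigr => j _.
  by rewrite /= !dotBr dotDr !dotZr; ring.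
(* The reflected point lies in each [K (k j)], so each summand of [T x] is at least [- m]. *)
have TKK x : KK x -> - (d%:R * m) <= T x.
  move=> Kx; have -> : - (d%:R * m) = \sum_(j < d) - m.
    by rewrite sumr_const card_ord -[RHS]mulr_natl mulrN.
  apply: ler_sum => j _; have := Hk j _ (gsym _ Kx (k j)).
  rewrite addrAC subrr add0r -scaleNr dotZr mulNr.
  rewrite lerNl ler_pdivlMl// mulrN1; lra.
(* Helly is applied to the [K i] and the open half-space where the bound on [T] fails. As [g] lies
   in every [K i], the half-space is selected, which leaves at most [d] of the [K i]. *)
pose C (o : option 'I_n) := if o is Some i then K i
  else [set x | T x < - (d%:R * m)].
have [||J [Jd HJ]] := @helly R d _ C.
- move=> [i|]; first exact: cK.
  move=> x y t /andP[t0 t1] /= Hx Hy; rewrite Tcomb.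
  by have [->|t0'] := eqVneq t 0; [lra|nra].
- move=> x; have [Kx|/existsNP[i Kx]] := pselect (KK x);
  last by exists (Some i).
  by exists None => /=; apply/negP; rewrite -leNgt; exact: TKK.
have NJ : None \in J by have [[i|//] _ /=] := HJ g; move=> /(_ (Kg i)).
pose J' := [set i | Some i \in J]%SET.
have J'd : (#|J'| <= d)%N.
  rewrite -(card_imset (mem J') (@Some_inj _)) -ltnS (leq_trans _ Jd)//.
  rewrite [ltnRHS](cardsD1 None) NJ add1n ltnS.
  apply: subset_leq_card; apply/fintype.subsetP.
  by move=> _ /imsetP[i iJ ->]; rewrite !inE/=; rewrite inE in iJ.
exists (J' :|: [set k j | j : 'I_d])%SET; split.
  rewrite (leq_trans (leq_card_setU _ _))// mul2n -addnn leq_add//.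
  by rewrite (leq_trans (leq_imset_card _ _))// card_ord.
exists g => x Hx i; apply: contrapT => /notK[a Aa].
rewrite addrAC subrr add0r dotZr; apply/negP; rewrite -leNgt.
have L0 : 0 < 10 * d%:R ^+ 2 :> R by rewrite mulr_gt0// exprn_gt0//; lra.
rewrite ler_pdivrMl// mulr1.
have Tx : - (d%:R * m) <= T x.
  have [[j jJ|_]] := HJ x; last by move/negP; rewrite -leNgt.
  by move=> /= Kj; exfalso; apply/Kj/Hx; rewrite !inE jJ.
have t1 j : dot (row j M) (x - g) <= 1.
  by apply/Hk/Hx; rewrite inE imset_f ?orbT.
have := M2 _ Aa; rewrite -[X in dot X _](mulmxKV Mu); move: (a *m _) => c c2.
(* After the shift by 2 the coefficients lie in [0, 4], so the sum is at most 4 d. The correction is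
   at most 2 d (2 d + 1), and the total at most 10 d^2 because d >= 1. *)
have -> : dot (c *m M) (x - g) =
    \sum_j (c 0 j + 2) * dot (row j M) (x - g) - 2 * T x.
  rewrite /T mulr_sumr -sumrB; under [RHS]eq_bigr do rewrite -mulrBl addrK.
  rewrite /dot; under [RHS]eq_bigr do rewrite mulr_sumr.
  rewrite exchange_big/=; apply: eq_bigr => l _; rewrite mxE mulr_suml.
  by apply: eq_bigr => j _; rewrite [row _ _ _ _]mxE mulrA.
have : \sum_j (c 0 j + 2) * dot (row j M) (x - g) <= \sum_(j < d) 4.
  apply: ler_sum => j _; have := c2 j; have := t1 j.
  by move: (dot _ _) => t; rewrite ler_norml => ? /andP[? ?]; nra.
rewrite sumr_const card_ord -mulr_natr; move: Tx; rewrite /m; nra.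
Qed.

(** * Lebesgue measure of homothetic sets, hyperplanes and convex sets *)

Lemma lebesgue_measure_affine (R : realType) (u s : R) (A : set R) :
  0 < s -> measurable A ->
  (s%:E * lebesgue_measure [set x : R | A (u + s * x)%R] =
   lebesgue_measure A)%E.
Proof.
move=> s0 mA; pose h (x : R) := u + s * x.
have mh : measurable_fun setT (h : measurableTypeR R -> measurableTypeR R).
  exact: measurable_funD (measurable_cst _) (measurable_funM (measurable_cst _)
    (@measurable_id _ _ _)).
pose m :=
  measure_function.measure_function_pushforward__canonical__measure_function_Measure
  lebesgue_measure mh.
pose r := NngNum (ltW s0); rewrite -[LHS]/(mscale r m A).
apply/esym; move: A mA.
apply: (lebesgue_measure_unique (mu := mscale r m)) => _ [[a b]] _ <-.
  rewrite -[RHS]/(s%:E * lebesgue_measure (h @^-1` `]a, b]%classic))%E.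
  have -> : h @^-1` `]a, b] = `](a - u) / s, (b - u) / s]%classic.
    apply/seteqP; split=> x;
      rewrite /= !in_itv/= /h ltr_pdivrMr// ler_pdivlMr//;
      by rewrite ltrBlDl lerBrDl (mulrC x).
  rewrite !lebesgue_measure_itv/= !lte_fin ltr_pM2r ?invr_gt0// ltrD2r.
  case: ifP => _; last by rewrite mule0.
  by rewrite -!EFinD -EFinM; congr EFin; field; exact: lt0r_neq0.
Qed.

Lemma measurable_fun_affine (R : realType) d (u : 'rV[R]_d) (s : R) :
  measurable_fun setT (fun x : 'rV[R]_d => u + s *: x).
Proof.
apply/measurable_fun_rVP => i.
under eq_fun do rewrite !mxE.
apply: measurable_funD; first exact: measurable_cst.
by apply: measurable_funM; [exact: measurable_cst|exact: measurable_coord].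
Qed.

Lemma measurable_affine_preimage (R : realType) d (u : 'rV[R]_d) (s : R)
    (A : set 'rV[R]_d) :
  measurable A -> measurable [set x | A (u + s *: x)].
Proof.
by move=> mA; rewrite -[X in measurable X]setTI; exact: measurable_fun_affine.
Qed.

(** Induction on the dimension: the rescaled pushforward agrees with the product measure on
    rectangles, hence everywhere by uniqueness. *)
Lemma lebesgue_rV_affine (R : realType) d (u : 'rV[R]_d) (s : R)
    (A : set 'rV[R]_d) :
  0 < s -> measurable A ->
  ((s ^+ d)%:E * lebesgue_rV d [set x | A (u + s *: x)%R] = lebesgue_rV d A)%E.
Proof.
move=> s0; elim: d => [|d IH] in u A *.
  move=> mA; rewrite expr0 mul1e; congr (lebesgue_rV 0 _).
  by apply/seteqP; split=> x /=; rewrite !(flatmx0, thinmx0).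
move=> mA.
pose h (p : measurableTypeR R * 'rV[R]_d) : measurableTypeR R * 'rV[R]_d :=
  (u 0 0 + s * p.1, (\row_j u 0 (lift ord0 j)) + s *: p.2).
have mh : measurable_fun setT h.
  apply/measurable_fun_pairP; split.
    exact: measurable_funD (measurable_cst _)
      (measurable_funM (measurable_cst _) measurable_fst).
  exact: (measurableT_comp (measurable_fun_affine _ _) measurable_snd).
have hE p : cons_rV (h p) = u + s *: cons_rV p.
  apply/rowP => j; have [k ->|->] := unliftP ord0 j.
    by rewrite cons_rV_lift !mxE liftK.
  by rewrite cons_rV0 !mxE unlift_none.
have sn0 : 0 <= s ^+ d.+1 by rewrite exprn_ge0// ltW.
have mcA : measurable (@cons_rV R d @^-1` A).
  by rewrite -[X in measurable X]setTI; exact: measurable_cons_rV.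
rewrite /= /lebesgue_rV_step /pushforward.
have -> : @cons_rV R d @^-1` [set x | A (u + s *: x)] =
    h @^-1` (@cons_rV R d @^-1` A).
  by apply/seteqP; split=> p /=; rewrite hE.
pose m :=
  measure_function.measure_function_pushforward__canonical__measure_function_Measure
  (lebesgue_measure \x lebesgue_rV d)%E mh.
pose r := NngNum sn0; rewrite -[LHS]/(mscale r m (@cons_rV R d @^-1` A)).
apply/esym; move: (_ @^-1` A) mcA.
apply: (product_measure_unique (m' := mscale r m)) => // B C mB mC.
rewrite -[LHS]/((s ^+ d.+1)%:E *
  (lebesgue_measure \x lebesgue_rV d) (h @^-1` (B `*` C)))%E.
have -> : h @^-1` (B `*` C) = [set x : R | B (u 0 0 + s * x)] `*`
    [set v | C (\row_j u 0 (lift ord0 j) + s *: v)] by [].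
rewrite product_measure1E//; last exact: measurable_affine_preimage.
  rewrite exprS EFinM muleACA.
  by rewrite lebesgue_measure_affine// IH.
rewrite -[X in measurable X]setTI.
by apply: (measurable_funD (measurable_cst (u 0 0))
  (measurable_funM (measurable_cst s) (@measurable_id _ (measurableTypeR R)
    setT))).
Qed.

Lemma lebesgue_rV_translate (R : realType) d (u : 'rV[R]_d) (A : set 'rV[R]_d) :
  measurable A -> lebesgue_rV d [set x | A (u + x)] = lebesgue_rV d A.
Proof.
move=> mA; have := lebesgue_rV_affine u ltr01 mA.
rewrite expr1n mul1e => <-; congr (lebesgue_rV d _).
by apply/seteqP; split=> x /=; rewrite scale1r.
Qed.

Lemma measurable_cube (R : realType) d (p : 'rV[R]_d) r : measurable (cube p r).
Proof.
rewrite [X in measurable X](_ : _ = \bigcap_(i in [set: 'I_d])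
  ((fun v : 'rV[R]_d => v ord0 i) @^-1` ball (p ord0 i) r)).
  apply: fin_bigcap_measurable => // i _.
  rewrite -[X in measurable X]setTI; apply: measurable_coord => //.
  by rewrite ball_itv; exact: measurable_itv.
apply/seteqP; split=> v /= Bv i => [_|].
  by rewrite /ball/= distrC; exact: Bv.
by rewrite distrC; exact: Bv.
Qed.

Lemma lebesgue_rV_cube (R : realType) d (p : 'rV[R]_d) r : 0 <= r ->
  lebesgue_rV d (cube p r) = ((r *+ 2) ^+ d)%:E.
Proof.
move=> r0.
have -> : cube p r = [set v | forall i, ball (p ord0 i) r (v ord0 i)].
  by apply/seteqP; split=> v Hv i; have := Hv i; rewrite /ball/= distrC.
rewrite (lebesgue_rV_box (A := fun i => ball (p ord0 i) r)) => [|i].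
  under eq_bigr do rewrite lebesgue_measure_ball//.
  by rewrite prodEFin prodr_const card_ord.
by rewrite ball_itv; exact: measurable_itv.
Qed.

(** The packing argument shared by the nullity of hyperplanes and the boundedness of convex sets of
    finite measure. *)
Lemma disjoint_translates (R : realType) d (A C : set 'rV[R]_d)
    (v : 'rV[R]_d) N :
  measurable A -> measurable C ->
  (forall k x, (k < N)%N -> A x -> C (x + k%:R *: v)) ->
  (forall k l x y, (k < l)%N -> A x -> A y -> x + k%:R *: v <> y + l%:R *: v) ->
  (N%:R%:E * lebesgue_rV d A <= lebesgue_rV d C)%E.
Proof.
move=> mA mC AC dA.
pose F (k : 'I_N) := [set x | A (- (k%:R *: v) + x)].
have mF k : measurable (F k).
  have := measurable_affine_preimage (- (k%:R *: v)) 1 mA.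
  by congr measurable; apply/seteqP; split=> x /=; rewrite scale1r.
have mU : measurable (\big[setU/set0]_(k < N) F k) by exact: bigsetU_measurable.
have -> : (N%:R%:E * lebesgue_rV d A =
    lebesgue_rV d (\big[setU/set0]_(k < N) F k))%E.
  rewrite measure_semi_additive_ord//.
    have FE k : lebesgue_rV d (F k) = lebesgue_rV d A.
      exact: lebesgue_rV_translate.
    rewrite (eq_bigr (fun=> lebesgue_rV d A)); last by move=> k _; exact: FE.
    have := measure_ge0 (lebesgue_rV d) A; move: (lebesgue_rV d A) => a a0.
    elim: (N) => [|k IH]; first by rewrite big_ord0 mul0e.
    by rewrite big_ord_recr/= -IH -natr1 EFinD ge0_muleDl ?mul1e ?lee_fin.
  apply/trivIsetP => /= k l _ _ kl; apply/seteqP; split=> // x [/= Ak Al].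
  have [] : (k < l)%N \/ (l < k)%N by apply/orP; rewrite -neq_ltn.
    by move=> /dA/(_ Ak Al); rewrite addrAC addNr add0r addrAC addNr add0r.
  by move=> /dA/(_ Al Ak); rewrite addrAC addNr add0r addrAC addNr add0r.
apply: le_measure; rewrite ?inE//.
rewrite -bigcup_seq => x [k _ /= /(AC _ _ (ltn_ord k))].
by rewrite addrAC addNr add0r.
Qed.

(** Along an axis on which [u] is not constant, the translates of a bounded piece of [S] are
    disjoint. Arbitrarily many of them fit into one cube, so the piece is null. *)
Lemma lebesgue_rV_hyperplane (R : realType) d (S : set 'rV[R]_d)
    (u : 'cV[R]_(1 + d)) :
  measurable S -> u != 0 -> (forall x, S x -> homog x *m u = 0) ->
  lebesgue_rV d S = 0%E.
Proof.
move=> mS u0 Su.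
have H x : S x -> usubmx u 0 0 + (x *m dsubmx u) 0 0 = 0.
  move=> /Su; rewrite -[u in _ *m u]vsubmxK mul_row_col mul1mx.
  by move=> /matrixP/(_ 0 0); rewrite [LHS]mxE [RHS]mxE.
have [du|/cV0Pn[j uj]] := eqVneq (dsubmx u) 0.
  suff -> : S = set0 by rewrite measure0.
  apply/seteqP; split=> // x /H; rewrite du mulmx0 [X in _ + X]mxE addr0 => uu.
  move/negP: u0; apply; rewrite -[u]vsubmxK du; apply/eqP.
  rewrite (_ : usubmx u = 0) ?col_mx0//.
  by apply/matrixP => i k; rewrite !ord1 uu mxE.
have mT k : measurable (S `&` cube 0 k%:R).
  by apply: measurableI => //; exact: measurable_cube.
have T0 k : lebesgue_rV d (S `&` cube 0 k%:R) = 0%E.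
  have HN N : (N.+1%:R%:E * lebesgue_rV d (S `&` cube 0 k%:R) <=
      lebesgue_rV d (cube (0 : 'rV[R]_d) k.+1%:R))%E.
    (* With steps of length 1 / (N + 1), the N + 1 translates move by at most 1. *)
    apply: (disjoint_translates (v := N.+1%:R^-1 *: delta_mx 0 j)) => //.
    - exact: measurable_cube.
    - move=> l x lN [_ xk] i;
      rewrite !mxE subr0 (le_lt_trans (ler_normD _ _))//.
      have /= := xk i; rewrite mxE subr0 -(natr1 k) => xki;
        apply: ltr_leD => //.
      rewrite mulrA; case: (_ == _); rewrite ?mulr0 ?normr0// mulr1.
      rewrite ger0_norm ?divr_ge0// ler_pdivrMr// mul1r ler_nat; exact: ltnW.
    - move=> l l' x y ll' [Sx _] [Sy _].
      move=> /(congr1 (fun z : 'rV[R]_d => (z *m dsubmx u) 0 0)).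
      have phiD (z v : 'rV[R]_d) t : ((z + t *: v) *m dsubmx u) 0 0 =
          (z *m dsubmx u) 0 0 + t * (v *m dsubmx u) 0 0.
        by rewrite mulmxDl -scalemxAl mxE [X in _ + X]mxE.
      rewrite !phiD; have := H _ Sx; have := H _ Sy.
      set e := ((_ *: _) *m _) 0 0; have e0 : e != 0.
        by rewrite /e -scalemxAl -rowE mxE [row _ _ _ _]mxE mulf_neq0//
          invr_eq0.
      move=> Hy Hx Hxy; have : (l'%:R - l%:R) * e = 0 by lra.
      move/eqP; rewrite mulf_eq0 (negbTE e0) orbF subr_eq0 eqr_nat.
      by rewrite gtn_eqF.
  apply/eqP; rewrite eq_le measure_ge0 andbT leNgt; apply/negP => T0.
  have CE := lebesgue_rV_cube (0 : 'rV[R]_d) (ler0n R k.+1).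
  rewrite CE in HN; move: (lebesgue_rV d _) T0 HN => [t||] //.
    rewrite lte_fin => t0 HN; set c := _ ^+ d in HN.
    have := HN (Num.truncn (c / t)); rewrite -EFinM lee_fin leNgt.
    by rewrite -ltr_pdivrMr// truncnS_gt.
  by move=> _ /(_ 0%N); rewrite mul1e leye_eq.
have -> : S = \bigcup_k (S `&` cube 0 k%:R).
  apply/seteqP; split=> [x Sx|x [k _ []//]].
  exists (Num.truncn (\sum_i `|x 0 i|)).+1 => //; split=> // i.
  rewrite mxE subr0; apply: le_lt_trans (truncnS_gt _).
  by rewrite (bigD1 i)//= lerDl sumr_ge0.
apply/(negligibleP _ (bigcupT_measurable _ mT))/negligible_bigcup => k.
exact: (proj2 (negligibleP _ (mT k)) (T0 k)).
Qed.

(** If [x] is far from [p], the half of the segment nearer to [p] carries many disjoint cubes inside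
    [L], too many for its volume. *)
Lemma convex_finite_measure_bounded (R : realType) d (L : set 'rV[R]_d) p r :
  measurable L -> is_convex L -> 0 < r -> cube p r `<=` L ->
  (lebesgue_rV d L < +oo)%E ->
  exists D, forall x, L x -> forall j, `|x 0 j| <= D.
Proof.
move=> mL cL r0 pL Loo.
have r20 : 0 <= r / 2 by lra.
pose c := (r / 2 *+ 2) ^+ d.
have c0 : 0 < c by rewrite exprn_gt0// pmulrn_lgt0// divr_gt0.
have [N0 HN0] : exists N0 : nat, fine (lebesgue_rV d L) < N0%:R * c.
  pose V := fine (lebesgue_rV d L) / c.
  exists (Num.truncn V).+1; rewrite -ltr_pdivrMr//; exact: truncnS_gt.
have N00 : 0 < N0%:R :> R.
  rewrite -(pmulr_lgt0 _ c0); apply: le_lt_trans HN0; exact: fine_ge0.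
exists (\sum_i `|p 0 i| + N0%:R * r * 2) => x Lx j.
suff H : `|x 0 j - p 0 j| <= N0%:R * r * 2.
  rewrite -[x 0 j](subrK (p 0 j)) (le_trans (ler_normD _ _))// addrC lerD//.
  by rewrite (bigD1 j)//= lerDl sumr_ge0.
rewrite leNgt; apply/negP => Hj; move: HN0; apply/negP; rewrite -leNgt.
set D := `|x 0 j - p 0 j| in Hj.
have D0 : 0 < D by apply: lt_trans Hj; rewrite !mulr_gt0.
rewrite -lee_fin fineK ?ge0_fin_numE// EFinM -(lebesgue_rV_cube p r20).
(* The [j]-th coordinate advances by [r], so cubes of half-width [r / 2] are disjoint. On the first
   half of the segment the cube shrunk towards [x] still has half-width at least [r / 2]. *)
apply: (disjoint_translates (v := (r / D) *: (x - p))) => //.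
- exact: measurable_cube.
- move=> k a kN ak; pose t := k%:R * (r / D).
  have t0 : 0 <= t by rewrite mulr_ge0// divr_ge0// ltW.
  have t2 : t <= 1 / 2.
    rewrite /t mulrA ler_pdivrMr//.
    have : k%:R <= N0%:R :> R by rewrite ler_nat ltnW.
    move: Hj; move: (D) => D'; nra.
  have -> : a + k%:R *: ((r / D) *: (x - p)) =
      t *: x + (1 - t) *: (p + (1 - t)^-1 *: (a - p)).
    rewrite scalerA -/t; apply/rowP => i; rewrite !mxE; field.
    by apply: lt0r_neq0; lra.
  apply: cL => //; first by rewrite t0; lra.
  apply: pL => i; rewrite !mxE addrAC subrr add0r normrM gtr0_norm; last first.
    by rewrite invr_gt0; lra.
  rewrite mulrC ltr_pdivrMr; last by lra.
  by apply: lt_le_trans (ak i) _; nra.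
- move=> k l a b kl ak bl /rowP/(_ j); rewrite !mxE => H.
  have Hab : (a 0 j - p 0 j) - (b 0 j - p 0 j) =
      (l%:R - k%:R) * (r / D * (x 0 j - p 0 j)).
    by rewrite mulrBl; lra.
  have : `|(a 0 j - p 0 j) - (b 0 j - p 0 j)| < r.
    by rewrite (le_lt_trans (ler_normB _ _))// (splitr r) ltrD.
  rewrite Hab normrM -natrB ?(ltnW kl)// normr_nat normrM -/D ger0_norm;
    last first.
    by rewrite divr_ge0 ?ltW.
  rewrite divfK ?lt0r_neq0// gtr_pMl// ltNge => /negP; apply.
  by rewrite ler1n subn_gt0.
Qed.

(** * Log-concave functions *)

Section log_concave.
Context (R : realType) (E : lmodType R).
Implicit Types (f : E -> R) (x y : E).

(** Where [f] is positive, [psi] is real and equal to [- ln f]; this turns the extended-valued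
    definition into a real inequality. *)
Lemma log_concave_ge_expR f x y t : log_concave f -> 0 < f x -> 0 < f y ->
  0 <= t <= 1 ->
  expR (t * ln (f x) + (1 - t) * ln (f y)) <= f (t *: x + (1 - t) *: y).
Proof.
move=> [psi [psiN cpsi fE]] fx fy t01; have := cpsi x y t t01.
have psi_real z : 0 < f z -> psi z = (- ln (f z))%:E.
  rewrite -lte_fin fE; have := psiN z; have := fE z; case: (psi z) => [a||] /=.
  - by move=> [->] _ _; rewrite expRK opprK.
  - by move=> _ _; rewrite ltxx.
  - by [].
rewrite (psi_real x)// (psi_real y)//.
have := fE (t *: x + (1 - t) *: y); have := psiN (t *: x + (1 - t) *: y).
case: (psi _) => [a _|_|//] /=; last first.
  by rewrite -!EFinM -EFinD leye_eq.
by move=> [->]; rewrite -!EFinM -EFinD lee_fin => H; rewrite ler_expR; lra.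
Qed.

Lemma log_concave_ge0 f x : log_concave f -> 0 <= f x.
Proof. by move=> [psi [_ _ fE]]; rewrite -lee_fin fE expeR_ge0. Qed.

Lemma is_convex_ge f c : log_concave f -> is_convex [set x | c <= f x].
Proof.
move=> lf x y t t01 /= cx cy; have [c0|c0] := leP c 0.
  exact: le_trans c0 (log_concave_ge0 _ lf).
have fx := lt_le_trans c0 cx; have fy := lt_le_trans c0 cy.
apply: le_trans (log_concave_ge_expR lf fx fy t01).
rewrite -{1}(lnK c0) ler_expR.
have : ln c <= ln (f x) by rewrite ler_ln.
have : ln c <= ln (f y) by rewrite ler_ln.
move: (ln c) (ln (f x)) (ln (f y)) => a b b'; move/andP: t01 => [? ?]; nra.
Qed.

Lemma is_convex_gt f c : log_concave f -> is_convex [set x | c < f x].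
Proof.
move=> lf x y t t01 /= cx cy.
apply: (@lt_le_trans _ _ (Num.min (f x) (f y))); first by rewrite lt_min cx.
by apply: is_convex_ge => //=; rewrite ge_min lexx ?orbT.
Qed.

(** The weights 1 / (k + 1) and k / (k + 1), with a power [k + 1] taken so that only natural
    exponents occur. *)
Lemma log_concave_expn f x y k : log_concave f -> 0 < f x -> 0 < f y ->
  f x * f y ^+ k <=
  f (k.+1%:R^-1 *: x + (1 - k.+1%:R^-1) *: y) ^+ k.+1.
Proof.
move=> lf fx fy; set t := k.+1%:R^-1.
have k0 : 0 < k.+1%:R :> R by [].
have t01 : 0 <= t <= 1 by rewrite invr_ge0 ltW//= invf_le1// ler1n.
have := log_concave_ge_expR lf fx fy t01.
set z := t *: x + _ => H.
apply: (@le_trans _ _ (expR (t * ln (f x) + (1 - t) * ln (f y)) ^+ k.+1)).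
  rewrite -expRM_natl mulrDr !mulrA mulrBr mulr1 divff ?lt0r_neq0// mul1r.
  rewrite -(natr1 k) addrK expRD expRM_natl !lnK//.
by rewrite lerXn2r// ?nnegrE ?expR_ge0//; exact: log_concave_ge0.
Qed.

End log_concave.

(** * Minima of log-concave functions and their integrals *)

Section min_fun.
Context (R : realType) (d n : nat) (f : 'I_n -> 'rV[R]_d -> R).
Implicit Types (s : {set 'I_n}) (x : 'rV[R]_d).

Definition minf s x : R := fine (min_fun_over f s x).

Lemma min_fun_over_attained s x : s != finset.set0 ->
  exists2 i, i \in s & min_fun_over f s x = (f i x)%:E.
Proof.
move=> /set0Pn[j js].
have [i is_ H] := @eq_bigmin _ _ _ +oo%E j (mem s) (fun i => (f i x)%:E) js
  (fun i _ => leey _).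
by exists i.
Qed.

Lemma min_fun_overE s x : s != finset.set0 ->
  min_fun_over f s x = (minf s x)%:E.
Proof. by move=> /min_fun_over_attained-/(_ x)[i _ H]; rewrite /minf H. Qed.

Lemma minf_attained s x : s != finset.set0 ->
  exists2 i, i \in s & minf s x = f i x.
Proof.
by move=> /min_fun_over_attained-/(_ x)[i si H]; exists i; rewrite // /minf H.
Qed.

Lemma minf_le s x i : i \in s -> minf s x <= f i x.
Proof.
move=> si; have s0 : s != finset.set0 by apply/set0Pn; exists i.
rewrite -lee_fin -min_fun_overE//; exact: bigmin_le_cond.
Qed.

Lemma minf_ge s x c : s != finset.set0 ->
  (c <= minf s x <-> forall i, i \in s -> c <= f i x).
Proof.
move=> s0; split=> [H i si|H]; first exact: le_trans H (minf_le _ si).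
by have [i /H + ->] := minf_attained x s0.
Qed.

Hypothesis f_usc : forall i, upper_semicontinuous (f i).

Lemma upper_semicontinuous_open i a : open [set x | f i x < a].
Proof. by rewrite openE => x; exact: f_usc. Qed.

Lemma upper_semicontinuous_closed i a : closed [set x | a <= f i x].
Proof.
rewrite (_ : [set x | _] = ~` [set x | f i x < a]).
  by apply: open_closedC; exact: upper_semicontinuous_open.
by apply/seteqP; split=> x /=; rewrite leNgt => /negP.
Qed.

Lemma measurable_minf_ge s a : s != finset.set0 ->
  measurable [set x | a <= minf s x].
Proof.
move=> s0; rewrite (_ : [set x | _] = \bigcap_(i in [set i | i \in s])
    ~` [set x | f i x < a]).
  apply: fin_bigcap_measurable => // i _; apply: measurableC.
  by apply: open_measurable_rV; exact: upper_semicontinuous_open.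
apply/seteqP; split=> x /= => [/(minf_ge _ _ s0) H i /= si|H].
  by apply/negP; rewrite -leNgt; exact: H.
by apply/(minf_ge _ _ s0) => i si; rewrite leNgt; apply/negP/H.
Qed.

Lemma measurable_min_fun_over s : s != finset.set0 ->
  measurable_fun setT (min_fun_over f s).
Proof.
move=> s0; apply: (eq_measurable_fun (EFin \o minf s)).
  by move=> x _ /=; rewrite min_fun_overE.
apply/measurable_EFinP.
move=> mT; apply: (measurability _ (RGenCInfty.measurableE R)) => //.
move=> /= _ [_ [a ->] <-];
  rewrite setTI [X in measurable X](_ : _ = [set x | a <= minf s x]).
  exact: measurable_minf_ge.
by apply/seteqP; split=> x /=; rewrite in_itv/= andbT.
Qed.

Hypothesis f_lc : forall i, log_concave (f i).

Lemma minf_ge0 s x : s != finset.set0 -> 0 <= minf s x.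
Proof. by move=> s0; apply/minf_ge => // i _; exact: log_concave_ge0. Qed.

Lemma is_convex_minf_ge s c : s != finset.set0 ->
  is_convex [set x | c <= minf s x].
Proof.
move=> s0 x y t t01 /= /(minf_ge _ _ s0) cx /(minf_ge _ _ s0) cy.
apply/(minf_ge _ _ s0) => i si.
exact: (is_convex_ge (f_lc i) t01 (cx i si) (cy i si)).
Qed.

Lemma minf_expn s x y k : s != finset.set0 -> 0 < minf s x -> 0 < minf s y ->
  minf s x * minf s y ^+ k <=
  minf s (k.+1%:R^-1 *: x + (1 - k.+1%:R^-1) *: y) ^+ k.+1.
Proof.
move=> s0 fx fy; set z := (_ *: _ + _).
have [i si ->] := minf_attained z s0.
have lx := minf_le x si; have ly := minf_le y si.
apply: (@le_trans _ _ (f i x * f i y ^+ k)).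
  by rewrite ler_pM ?exprn_ge0 ?(ltW fx) ?(ltW fy)// lerXn2r ?nnegrE// ltW//
    (lt_le_trans fy).
by apply: log_concave_expn => //; [exact: lt_le_trans lx|exact: lt_le_trans ly].
Qed.

Lemma markov_minf s (A : set 'rV[R]_d) c : s != finset.set0 -> measurable A ->
  0 <= c -> (forall x, A x -> c <= minf s x) ->
  (c%:E * lebesgue_rV d A <= \int[lebesgue_rV d]_x min_fun_over f s x)%E.
Proof.
move=> s0 mA c0 Ac; have mf := measurable_min_fun_over s0.
have f0 x : (0 <= min_fun_over f s x)%E.
  by rewrite min_fun_overE// lee_fin; exact: minf_ge0.
rewrite -integral_cst//.
apply: (@le_trans _ _ (\int[lebesgue_rV d]_(x in A) min_fun_over f s x)%E).
  apply: ge0_le_integral => //.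
    exact: measurable_funS mf.
  by move=> x Ax; rewrite min_fun_overE// lee_fin; exact: Ac.
exact: ge0_subset_integral.
Qed.

End min_fun.

(* On the k-th shell {c B^-(k+1) <= h <= c B^-k} the volume grows like (k+1)^d
   while h decays like B^-k; the choice B = 4^d makes the series sum to 2. *)
Lemma integral_le_shells (R : realType) d (h : 'rV[R]_d -> \bar R)
    (K : set 'rV[R]_d) (c s V : R) (u : nat -> 'rV[R]_d) :
  (0 < d)%N -> measurable_fun setT h -> (forall x, 0 <= h x)%E ->
  measurable K -> lebesgue_rV d K = V%:E -> 0 <= c -> 0 < s ->
  (forall x, (0 < h x)%E -> exists k,
    (h x <= (c / 4 ^+ (d * k))%:E)%E /\ K (u k + (s * k.+1%:R)^-1 *: x)) ->
  (\int[lebesgue_rV d]_x h x <= (2 * c * s ^+ d * V)%:E)%E.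
Proof.
move=> d0 mh h0 mK KV c0 s0 hK.
have V0 : 0 <= V by rewrite -lee_fin -KV measure_ge0.
have sk0 k : 0 < s * k.+1%:R by rewrite mulr_gt0.
pose E k := [set x | K (u k + (s * k.+1%:R)^-1 *: x)].
have mE k : measurable (E k) by exact: measurable_affine_preimage.
have EV k : lebesgue_rV d (E k) = ((s * k.+1%:R) ^+ d * V)%:E.
  have := lebesgue_rV_affine (u k) (s := (s * k.+1%:R)^-1) _ mK.
  rewrite invr_gt0 sk0 -/(E k) => /(_ isT); rewrite KV.
  move=> /(congr1 (fun e => ((s * k.+1%:R) ^+ d)%:E * e)%E).
  rewrite muleA -!EFinM -exprMn divff ?expr1n ?mul1e// lt0r_neq0//.
pose w k := c / 4 ^+ (d * k).
have w0 k : 0 <= w k by rewrite divr_ge0// exprn_ge0.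
pose F k x := ((w k)%:E * (\1_(E k) x)%:E)%E.
have F0 k x : (0 <= F k x)%E by rewrite mule_ge0 ?lee_fin.
have mF k : measurable_fun setT (F k).
  by apply: measurable_funeM; apply/measurable_EFinP; exact: measurable_indic.
apply: (@le_trans _ _ (\int[lebesgue_rV d]_x \sum_(0 <= k <oo) F k x)%E).
  apply: ge0_le_integral => //.
    by apply: ge0_emeasurable_sum => //.
  move=> x _; have [hx|hx] := leP (h x) 0%E.
    by apply: le_trans hx _; exact: nneseries_ge0.
  have [k [hk Kx]] := hK x hx.
  apply: le_trans (nneseries_lim_ge k.+1 _) => //.
  rewrite big_nat_recr//=; apply: le_trans (leeDr _ (sume_ge0 _ _)) => //.
  by rewrite /F indicE mem_set// mule1.
rewrite integral_nneseries//.
(* As k + 1 <= 2^k, the k-th term is at most c s^d V / 2^k. It is written with denominator 2^(k+1)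
   to fit [epsilon_trick], applied below to the zero sequence. *)
have IF k : (\int[lebesgue_rV d]_x F k x <=
    ((2 * c * s ^+ d * V) / (2 ^ k.+1)%:R)%:E)%E.
  rewrite ge0_integralZl_EFin//; last first.
    by apply/measurable_EFinP; exact: measurable_indic.
  rewrite integral_indic// setIT [X in (_ * X)%E]EV -EFinM lee_fin.
  have k2 : k.+1%:R <= 2 ^+ k :> R by rewrite -natrX ler_nat ltn_expl.
  have p2 : 0 < 2 ^+ k :> R by rewrite exprn_gt0.
  have -> : w k * ((s * k.+1%:R) ^+ d * V) =
      c * s ^+ d * V * (k.+1%:R / 4 ^+ k) ^+ d.
    by rewrite /w exprMn mulnC exprM expr_div_n; ring.
  have -> : 2 * c * s ^+ d * V / (2 ^ k.+1)%:R = c * s ^+ d * V * (2 ^+ k)^-1.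
    by rewrite natrX exprS; field; rewrite lt0r_neq0.
  rewrite ler_wpM2l// ?mulr_ge0 ?exprn_ge0 ?(ltW s0)//.
  have H : k.+1%:R / 4 ^+ k <= (2 ^+ k)^-1 :> R.
    rewrite ler_pdivrMr ?exprn_gt0// ler_pdivlMl//.
    rewrite (_ : 4 = 2 * 2 :> R) ?exprMn ?ler_pM2l//; lra.
  apply: le_trans (_ : (2 ^+ k)^-1 ^+ d <= _).
    by rewrite lerXn2r// nnegrE ?divr_ge0 ?exprn_ge0// invr_ge0 ltW.
  by rewrite ler_iXnr// ?invr_ge0 ?(ltW p2)// invf_le1// exprn_ege1// ler1n.
apply: le_trans (lee_nneseries _ (fun k _ => IF k)) _.
  by move=> k _ _; exact: integral_ge0.
have e0 : 0 <= 2 * c * s ^+ d * V by rewrite !mulr_ge0 ?exprn_ge0// ltW.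
have := @epsilon_trick R (fun=> 0%E) _ xpredT (fun=> lexx _) e0.
rewrite [X in (_ <= X + _)%E]eseries0// add0e; apply: le_trans.
by apply: lee_nneseries => k _; rewrite ?add0e// lee_fin divr_ge0.
Qed.

(** * Selection of indices for log-concave functions *)

Section helly_log_concave.
Context (R : realType) (d n : nat) (f : 'I_n -> 'rV[R]_d -> R).
Hypothesis f_usc : forall i, upper_semicontinuous (f i).
Hypothesis f_lc : forall i, log_concave (f i).
Implicit Types (s : {set 'I_n}) (x p : 'rV[R]_d).

(** [C i] is the interior of the support of [f i]. A cube in the common support of the selected
    functions would put its center in all their [C i]; so that support lies in a hyperplane and is
    null. *)
Lemma helly_degenerate_support :
  (forall p r, 0 < r -> exists i, ~ cube p r `<=` [set x | 0 < f i x]) ->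
  exists s, [/\ s != finset.set0, (#|s| <= d.+1)%N &
    (\int[lebesgue_rV d]_x min_fun_over f s x = 0)%E].
Proof.
move=> Hf.
pose C i := [set p | exists2 r, 0 < r & cube p r `<=` [set x | 0 < f i x]].
have cC i : is_convex (C i).
  move=> x y t t01 [r r0 xr] [r' r'0 yr'].
  exists (Num.min r r'); first by rewrite lt_min r0.
  (* Interiors of convex sets are convex: both end points are displaced by the same vector [e]. *)
  move=> z Hz; set e := z - (t *: x + (1 - t) *: y).
  have -> : z = t *: (x + e) + (1 - t) *: (y + e).
    by apply/rowP => j; rewrite !mxE; ring.
  have He j : `|e 0 j| < Num.min r r' by have := Hz j; rewrite !mxE.
  apply: is_convex_gt => //; [apply: xr|apply: yr'] => j.
    by have := He j; rewrite lt_min [(_ + e) _ _]mxE addrAC subrr add0r =>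
      /andP[].
  by have := He j; rewrite lt_min [(_ + e) _ _]mxE addrAC subrr add0r =>
    /andP[].
have C0 x : exists i, ~ C i x.
  apply: contrapT => /forallNP HC.
  have /choice[r Hr] i : exists r, 0 < r /\ cube x r `<=` [set x | 0 < f i x].
    by have /contrapT[r r0 Hr] := HC i; exists r.
  have [] := Hf x (\big[Num.min/1]_i r i).
    by rewrite lt_bigmin// => i _; have [] := Hr i.
  move=> i; apply => y Hy; apply: (Hr i).2 => j.
  by apply: lt_le_trans (Hy j) _; exact: bigmin_le_cond.
have [J [Jd HJ]] := helly cC C0.
have J0 : J != finset.set0 by have [i iJ _] := HJ 0; apply/set0Pn; exists i.
exists J; split=> //.
pose S := [set x | (0 < min_fun_over f J x)%E].
have SE x : S x <-> 0 < minf f J x by rewrite /S/= min_fun_overE.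
have mf := measurable_min_fun_over f_usc J0.
have mS : measurable S.
  have := emeasurable_fun_o_infty measurableT mf 0%E.
  by rewrite setTI.
have cS : is_convex S.
  move=> x y t t01 /SE Sx /SE Sy; apply/SE.
  apply: (@lt_le_trans _ _ (Num.min (minf f J x) (minf f J y))).
    by rewrite lt_min Sx.
  by apply: is_convex_minf_ge => //=; rewrite ge_min lexx ?orbT.
have S0 : lebesgue_rV d S = 0%E.
  have [[g [r [r0 gS]]]|[u u0 Su]] := convex_cube_or_hyperplane cS; last first.
    exact: lebesgue_rV_hyperplane Su.
  have [i iJ []] := HJ g; exists r => // x /gS/SE xS /=.
  exact: lt_le_trans (minf_le _ _ iJ).
rewrite (_ : 0%E = \int[lebesgue_rV d]_x cst 0%E x)%E; last first.
  by rewrite integral0.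
apply: ae_eq_integral => //.
exists S; split=> // x /= /not_implyP[_ nx]; apply/SE.
rewrite lt_neqAle (minf_ge0 f_lc)// andbT; apply/eqP => x0; apply: nx.
by rewrite min_fun_overE// -x0.
Qed.

(** The midpoints between [y] and the points of the cube fill a cube of half-width [r / 2], on which
    the minimum is at least the geometric mean of its value at [y] and [c]. Markov's inequality
    bounds that mean. *)
Lemma minf_bounded s c p r : s != finset.set0 -> 0 < c -> 0 < r ->
  cube p r `<=` [set x | c <= minf f s x] ->
  (\int[lebesgue_rV d]_x min_fun_over f s x < +oo)%E ->
  exists T, forall x, minf f s x <= T.
Proof.
move=> s0 c0 r0 pc Ioo.
set I := (\int[_]_x _)%E in Ioo.
have I0 : (0 <= I)%E.
  by apply: integral_ge0 => x _; rewrite min_fun_overE// lee_fin minf_ge0.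
pose V := (r / 2 *+ 2) ^+ d.
have V0 : 0 < V by rewrite exprn_gt0// pmulrn_lgt0// divr_gt0.
exists ((fine I / V) ^+ 2 / c) => y.
have [y0|y0] := leP (minf f s y) 0.
  by apply: le_trans y0 _; rewrite divr_ge0 ?sqr_ge0// ltW.
pose t := Num.sqrt (minf f s y * c).
have tt : t ^+ 2 = minf f s y * c by rewrite sqr_sqrtr// mulr_ge0// ltW.
have : (t%:E * lebesgue_rV d (cube ((1 / 2) *: (y + p)) (r / 2)) <= I)%E.
  apply: markov_minf => //; [exact: measurable_cube|exact: sqrtr_ge0|].
  move=> x Hx; have Hz : c <= minf f s (2 *: x - y).
    apply: pc => j; have := Hx j; rewrite !mxE => Hj.
    rewrite (_ : _ - _ = 2 * (x 0 j - 1 / 2 * (y 0 j + p 0 j))); last by field.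
    by rewrite normrM ger0_norm//; lra.
  have := minf_expn f_lc 1 s0 y0 (lt_le_trans c0 Hz).
  rewrite (_ : _ *: y + _ = x); last by apply/rowP => j; rewrite !mxE; field.
  move=> H; rewrite -(@ler_pXn2r _ 2) ?nnegrE ?sqrtr_ge0 ?minf_ge0// tt.
  by apply: le_trans H; rewrite expr1 ler_pM2l.
rewrite lebesgue_rV_cube ?divr_ge0 ?(ltW r0)// -/V => tI.
have {}tI : t <= fine I / V.
  by rewrite ler_pdivlMr// -lee_fin fineK ?ge0_fin_numE// EFinM.
rewrite ler_pdivlMr// -tt lerXn2r ?nnegrE ?sqrtr_ge0//.
by rewrite divr_ge0 ?fine_ge0// ltW.
Qed.

(** The lower of the two levels contains the cube and has finite measure by Markov's inequality, so
    it is bounded. *)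
Lemma minf_level_bounded s c c' p r : s != finset.set0 ->
  0 < c -> 0 < c' -> 0 < r ->
  cube p r `<=` [set x | c <= minf f s x] ->
  (\int[lebesgue_rV d]_x min_fun_over f s x < +oo)%E ->
  exists D, forall x, c' <= minf f s x -> forall j, `|x 0 j| <= D.
Proof.
move=> s0 c0 c'0 r0 pc Ioo; pose m := Num.min c c'.
have m0 : 0 < m by rewrite lt_min c0.
have mL : measurable [set x | m <= minf f s x] by exact: measurable_minf_ge.
have [||D HD] := @convex_finite_measure_bounded R d _ p r mL
    (is_convex_minf_ge f_lc s0) r0.
- by move=> x /pc /=; apply: le_trans; rewrite ge_min lexx.
- rewrite ltNge; apply/negP; rewrite leye_eq => /eqP Loo.
  have := markov_minf f_usc f_lc s0 mL (ltW m0) (fun x H => H).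
  by rewrite Loo gt0_muley ?lte_fin// leye_eq => /eqP H; rewrite H in Ioo.
by exists D => x c'x; apply: HD; rewrite /= ge_min c'x orbT.
Qed.

(* Contracting the cube towards x0 by the factor 1 / (k + 1) makes the value of
   c irrelevant for large k, since the level has room B^(k+1) below M / 2. *)
Lemma minf_level_cube s c M B p r x0 : s != finset.set0 ->
  0 < c -> 0 < M -> 2 <= B -> 0 < r ->
  cube p r `<=` [set x | c <= minf f s x] -> M / 2 <= minf f s x0 ->
  exists p' r', 0 < r' /\ cube p' r' `<=` [set x | M / (2 * B) <= minf f s x].
Proof.
move=> s0 c0 M0 B2 r0 pc x0M.
have B0 : 0 < B by lra.
have [k Hk] : exists k, M <= 2 * c * B ^+ k.+1.
  exists (Num.truncn (M / (2 * c))); rewrite -ler_pdivrMl ?mulr_gt0//.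
  rewrite mulrC; apply: le_trans (ltW (truncnS_gt _)) _.
  apply: (@le_trans _ _ (2 ^+ (Num.truncn (M / (2 * c))).+1)).
    by rewrite -natrX ler_nat ltnW// ltn_expl.
  by rewrite lerXn2r ?nnegrE//; lra.
pose t : R := k.+1%:R^-1.
have t0 : 0 < t by rewrite invr_gt0.
have x00 : 0 < minf f s x0 by apply: lt_le_trans x0M; rewrite divr_gt0.
exists (t *: p + (1 - t) *: x0), (t * r); split; first exact: mulr_gt0.
move=> z Hz; pose q := p + k.+1%:R *: (z - (t *: p + (1 - t) *: x0)).
have qp : cube p r q.
  move=> j.
  have -> : q 0 j - p 0 j = k.+1%:R * (z 0 j - (t *: p + (1 - t) *: x0) 0 j).
    by rewrite /q !mxE; ring.
  by rewrite normrM normr_nat -ltr_pdivlMl//; exact: Hz.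
have zE : z = t *: q + (1 - t) *: x0.
  by apply/rowP => j; rewrite /q /t !mxE; field; rewrite addrC natr1.
have cq : c <= minf f s q by exact: pc.
have := minf_expn f_lc k s0 (lt_le_trans c0 cq) x00.
rewrite -zE => H.
rewrite /= -(@ler_pXn2r _ k.+1) ?nnegrE ?minf_ge0 ?divr_ge0 ?mulr_ge0 ?(ltW M0)
  ?(ltW B0)//.
apply: le_trans H; apply: (@le_trans _ _ (c * (M / 2) ^+ k)).
  rewrite invfM mulrA exprMn exprVn ler_pdivrMr ?exprn_gt0// exprS.
  have : 0 <= (M / 2) ^+ k by rewrite exprn_ge0// divr_ge0// ltW.
  by move: ((M / 2) ^+ k) (B ^+ _) Hk => X Y; nra.
rewrite ler_pM ?(ltW c0) ?exprn_ge0 ?divr_ge0 ?(ltW M0)//.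
by rewrite lerXn2r ?nnegrE ?divr_ge0 ?(ltW M0) ?(ltW x00).
Qed.

(** Upper semi-continuity gives no lower bound near a point; convexity of the level sets gives one
    on a simplex, the least value at its vertices. *)
Lemma cube_minf_gt0 s p r : s != finset.set0 -> 0 < r ->
  cube p r `<=` [set x | 0 < minf f s x] ->
  exists c p' r', [/\ 0 < c, 0 < r' &
    cube p' r' `<=` [set x | c <= minf f s x]].
Proof.
move=> s0 r0 pS.
have [M [AM Mu]] := basis_of_spanning (fun u => cube_spanning r0 pS).
have /choice[v Hv] i : exists v, 0 < minf f s v /\ row i M = homog v.
  by have [v Sv vM] := AM i; exists v.
pose c := \big[Num.min/1]_i minf f s (v i).
have [|r' r'0 Hr'] := simplex_cube (is_convex_minf_ge f_lc (c := c) s0)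
   (fun i => (Hv i).2) Mu.
  by move=> i /=; exact: bigmin_le_cond.
exists c, ((1 + d)%:R^-1 *: \sum_i v i), r'; split=> //.
by rewrite lt_bigmin// => i _; have [] := Hv i.
Qed.

Lemma helly_full_support p r :
  (0 < d)%N -> finset.setT != finset.set0 :> {set 'I_n} ->
  0 < r -> cube p r `<=` [set x | 0 < minf f finset.setT x] ->
  (\int[lebesgue_rV d]_x min_fun_over f finset.setT x < +oo)%E ->
  exists s, [/\ s != finset.set0, (#|s| <= 3 * d + 2)%N &
    (\int[lebesgue_rV d]_x min_fun_over f s x <=
     (4 * (40 * d%:R ^+ 2) ^+ d)%:E *
     \int[lebesgue_rV d]_x min_fun_over f finset.setT x)%E].
Proof.
move=> d0 T0 r0 pS Ioo; pose g := minf f finset.setT.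
have g0 x : 0 <= g x by exact: minf_ge0.
have [c [q [r' [c0 r'0 qc]]]] := cube_minf_gt0 T0 r0 pS.
have [U HU] := minf_bounded T0 c0 r'0 qc Ioo.
have hM : has_sup (range g).
  by split; [exists (g 0), 0|exists U => _ [x _ <-]; exact: HU].
pose M := sup (range g).
have gM x : g x <= M by apply: (ub_le_sup hM.2); exists x.
have M0 : 0 < M.
  by apply: lt_le_trans (gM q); apply: lt_le_trans c0 _; exact/qc/cube_center.
have [_ [x0 _ <-] Mx0] : exists2 y, range g y & M - M / 2 < y.
  by apply: sup_adherent => //; rewrite divr_gt0.
have {}Mx0 : M / 2 <= g x0 by lra.
pose B : R := 4 ^+ d.
have B2 : 2 <= B.
  rewrite /B -(prednK d0) exprS.
  have H : 1 <= 4 ^+ d.-1 :> R by apply: exprn_ege1; lra.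
  lra.
have B0 : 0 < B by lra.
pose c1 := M / (2 * B).
have c10 : 0 < c1 by rewrite divr_gt0 ?mulr_gt0.
have [q' [r'' [r''0 q'K]]] := minf_level_cube T0 c0 M0 B2 r'0 qc Mx0.
have [D HD] := minf_level_bounded T0 c0 c10 r'0 qc Ioo.
have levelP x : c1 <= g x <-> forall i, c1 <= f i x.
  rewrite /g minf_ge//; split=> [H i|H i _]; last exact: H.
  by apply: H; rewrite inE.
have [|||||s2 [s2d [v Hv]]] := @helly_homothet R d n
    (fun i => [set x | c1 <= f i x]) q' r'' D d0.
- by move=> i; exact: upper_semicontinuous_closed.
- by move=> i; exact: is_convex_ge.
- exact: r''0.
- by move=> i x /q'K/levelP/(_ i).
- by move=> x /levelP; exact: HD.
have [||s1 [s1d Hs1]] := @helly R d _ (fun i => [set x | M < f i x]).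
- by move=> i; exact: is_convex_gt.
- move=> x; have [i _ gi] := minf_attained f x T0.
  by exists i; apply/negP; rewrite -leNgt -gi; exact: gM.
have s10 : s1 != finset.set0.
  by have [i i1 _] := Hs1 0; apply/set0Pn; exists i.
pose s := (s1 :|: s2)%SET.
have s0 : s != finset.set0.
  by have /set0Pn[i i1] := s10; apply/set0Pn; exists i; rewrite inE i1.
exists s; split=> //.
  (* The count is (d + 1) + 2 d = 3 d + 1. *)
  rewrite (leq_trans (leq_card_setU _ _))// (leq_trans (leq_add s1d s2d))//.
  by rewrite (mulnDl 1 2) mul1n addSn addn2 leqnSn.
pose h := minf f s.
have hM' x : h x <= M.
  have [i i1 /negP] := Hs1 x; rewrite -leNgt; apply: le_trans.
  by apply: minf_le; rewrite inE i1.
have gh x : g x <= h x.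
  by apply/minf_ge => // i _; apply: minf_le; rewrite inE.
have Mhx0 : M / 2 <= h x0 by exact: le_trans (gh x0).
have hx0 : 0 < h x0 by apply: lt_le_trans Mhx0; rewrite divr_gt0.
pose L : R := 10 * d%:R ^+ 2.
have L0 : 0 < L by rewrite mulr_gt0// exprn_gt0// ltr0n.
pose K := [set x | c1 <= g x].
have mK : measurable K by exact: measurable_minf_ge.
have markov : (c1%:E * lebesgue_rV d K <=
    \int[lebesgue_rV d]_x min_fun_over f finset.setT x)%E.
  by apply: markov_minf => //; exact: ltW.
have [V KV] : exists V, lebesgue_rV d K = V%:E.
  exists (fine (lebesgue_rV d K)); rewrite fineK// ge0_fin_numE//.
  rewrite ltNge; apply/negP; rewrite leye_eq => /eqP Koo.
  by move: markov; rewrite Koo gt0_muley ?lte_fin// leNgt Ioo.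
(* Chosen so that [u k + (L * k.+1%:R)^-1 *: x] is the image of the point [z] below under the
   homothety of center [v] and ratio [L^-1]. *)
pose u k := v - L^-1 *: v + (L^-1 * (1 - k.+1%:R^-1)) *: x0.
(* The shells give the bound [2 * M * L ^+ d * V]. Here 2 M = 4 B c1, B L^d = (40 d^2)^d, and c1 V
   is at most the integral of the full minimum. *)
apply: le_trans (_ : (2 * M * L ^+ d * V)%:E <= _)%E; last first.
  have -> : 2 * M * L ^+ d * V = 4 * (40 * d%:R ^+ 2) ^+ d * (c1 * V).
    have -> : 40 * d%:R ^+ 2 = 4 * L :> R by rewrite /L; ring.
    have -> : (4 * L) ^+ d = B * L ^+ d by rewrite [LHS]exprMn.
    rewrite /c1; field; exact: lt0r_neq0.
  rewrite [leLHS]EFinM; apply: lee_wpmul2l; last by rewrite EFinM -KV.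
  by rewrite lee_fin mulr_ge0// exprn_ge0// mulr_ge0// exprn_ge0.
apply: (integral_le_shells (K := K) (u := u)) => //.
- exact: measurable_min_fun_over.
- by move=> x; rewrite min_fun_overE// lee_fin; exact: minf_ge0.
- exact: ltW.
move=> x; rewrite min_fun_overE// lte_fin -/h => hx.
have [k [hk1 hk2]] : exists k, M / B ^+ k.+1 <= h x /\ h x <= M / B ^+ k.
  have ex : exists k, M / B ^+ k.+1 <= h x.
    exists (Num.truncn (M / h x)); rewrite ler_pdivrMr ?exprn_gt0//.
    rewrite -ler_pdivrMl// mulrC; apply: le_trans (ltW (truncnS_gt _)) _.
    apply: (@le_trans _ _ (2 ^+ (Num.truncn (M / h x)).+1)).
      by rewrite -natrX ler_nat ltnW// ltn_expl.
    by rewrite lerXn2r ?nnegrE//; lra.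
  have [k kP kmin] := ex_minnP ex; exists k; split=> //.
  case: k kP kmin => [_ _|k _ kmin]; first by rewrite expr0 divr1.
  by rewrite leNgt; apply/negP => /ltW /kmin; rewrite ltnn.
exists k; split; first by rewrite lee_fin exprM.
pose z := k.+1%:R^-1 *: x + (1 - k.+1%:R^-1) *: x0.
(* Indeed h(z)^(k+1) >= h(x) h(x0)^k >= (M / B^(k+1)) (M / 2)^k, which is at least c1^(k+1). *)
have hz : c1 <= h z.
  have := minf_expn f_lc k s0 hx hx0.
  rewrite -/z => H.
  rewrite -(@ler_pXn2r _ k.+1) ?nnegrE ?(ltW c10) ?minf_ge0//.
  apply: le_trans H; apply: (@le_trans _ _ (M / B ^+ k.+1 * (M / 2) ^+ k)).
    rewrite /c1 invfM mulrA exprMn exprVn [leRHS]mulrAC ler_pM2r ?invr_gt0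
      ?exprn_gt0//.
    rewrite exprS ler_pM2r ?exprn_gt0 ?divr_gt0//; lra.
  by rewrite ler_pM ?exprn_ge0 ?divr_ge0 ?(ltW M0) ?exprn_ge0 ?(ltW B0)//
    lerXn2r ?nnegrE ?divr_ge0 ?(ltW M0)//; exact: minf_ge0.
have Hz i : i \in s2 -> c1 <= f i z.
  by move=> i2; apply: le_trans hz _; apply: minf_le; rewrite inE i2 orbT.
have := Hv _ Hz => /levelP; rewrite /K /=; congr (_ <= g _).
apply/rowP => j; rewrite /u /z !mxE -/L; field.
by rewrite (lt0r_neq0 L0) andbT addrC natr1 pnatr_eq0.
Qed.

End helly_log_concave.

(** * Comparison of constants and conclusion *)

(** The factor 4 is at most 4^d and 160 d^2 <= (100 d)^2; then the exponent 2 d is raised to 5 d /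
    2, the base being at least 1. *)
Lemma constant_le_powR (R : realType) d : (0 < d)%N ->
  4 * (40 * d%:R ^+ 2) ^+ d <= (100 * d%:R) `^ (5 * d%:R / 2) :> R.
Proof.
move=> d0; have d1 : 1 <= d%:R :> R by rewrite ler1n.
apply: (@le_trans _ _ ((100 * d%:R) `^ (2 * d)%:R)).
  rewrite powR_mulrn; last by rewrite mulr_ge0.
  rewrite exprM; apply: (@le_trans _ _ ((4 * (40 * d%:R ^+ 2)) ^+ d)).
    rewrite [leRHS]exprMn ler_wpM2r ?exprn_ge0 ?mulr_ge0 ?exprn_ge0//.
    rewrite -(prednK d0) exprS ler_peMr//; apply: exprn_ege1; lra.
  rewrite lerXn2r ?nnegrE ?mulr_ge0 ?exprn_ge0//; nra.
apply: ler_powR; last by rewrite natrM; lra.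
lra.
Qed.

Unset Implicit Arguments.
Local Close Scope classical_set_scope.

Theorem theorem1p2 (R : realType) (d n : nat)
    (d_ge1 : (1 <= d)%N) (n_ge1 : (1 <= n)%N)
    (f : 'I_n -> 'rV[R]_d -> R)
    (f_ge0 : forall i x, 0 <= f i x)
    (f_usc : forall i, upper_semicontinuous (f i))
    (f_lc : forall i, log_concave (f i)) :
  exists sigma : {set 'I_n},
    [/\ sigma != finset.set0,
        (#|sigma| <= 3 * d + 2)%N &
        (\int[lebesgue_rV d]_x min_fun_over f sigma x <=
         ((100 * d%:R) `^ (5 * d%:R / 2))%:E *
         \int[lebesgue_rV d]_x min_fun_over f finset.setT x)%E].
Proof.
have T0 : finset.setT != finset.set0 :> {set 'I_n}.
  by apply/set0Pn; exists (Ordinal n_ge1); rewrite inE.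
have I0 : (0 <= \int[lebesgue_rV d]_x min_fun_over f finset.setT x)%E.
  by apply: integral_ge0 => x _; rewrite min_fun_overE// lee_fin minf_ge0.
(* If the integral of the full minimum is infinite, so is the right-hand side, and any single index
   will do. *)
have [Ioo|Ioo] := eqVneq
  (\int[lebesgue_rV d]_x min_fun_over f finset.setT x)%E +oo%E.
  exists (finset.set1 (Ordinal n_ge1)); split.
  - by apply/set0Pn; exists (Ordinal n_ge1); rewrite inE.
  - by rewrite cards1 addn2.
  - by rewrite Ioo gt0_muley ?leey// lte_fin powR_gt0// mulr_gt0// ltr0n.
have [[p [r [r0 pS]]]|nS] := pselect (exists p r, 0 < r /\
    forall i, (cube p r `<=` [set x | 0 < f i x])%classic).
  have [||s [s0 sd Hs]] := helly_full_support f_usc f_lc d_ge1 T0 r0 (p := p).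
  - move=> x px; have [i _ /= ->] := minf_attained f x T0; exact: pS px.
  - by rewrite ltey.
  exists s; split=> //; apply: le_trans Hs _.
  by apply: lee_wpmul2r => //; rewrite lee_fin constant_le_powR.
have [|s [s0 sd Is]] := helly_degenerate_support f_usc f_lc.
  move=> p r r0; apply: contrapT => /forallNP H; apply: nS; exists p, r.
  by split=> // i; have /contrapT := H i.
exists s; split=> //; last by rewrite Is mule_ge0// lee_fin powR_ge0.
by rewrite (leq_trans sd)// -(addn1 d) leq_add// leq_pmull.
Qed.
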